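(* On the Lie algebra $\mathfrak{h}_5\oplus\mathbb{R}^2$ there exist purely coclosed $\mathrm{G}_2$-structures inducing a nilsoliton metric, while the nilsoliton metrics on $\mathfrak{h}_7$ are not induced by any purely coclosed $\mathrm{G}_2$-structure.
   Context: $\mathfrak{h}_n$ is the (real) Heisenberg Lie algebra of dimension $n$. In terms of the tuple $(\mathrm{d}f^1,\dots,\mathrm{d}f^7)$ for a basis $\{f^i\}$ of the dual, $f^{ij}=f^i\wedge f^j$: $\mathfrak{h}_5\oplus\mathbb{R}^2=(0,0,0,0,0,0,f^{12}+f^{34})$, $\mathfrak{h}_7=(0,0,0,0,0,0,f^{12}+f^{34}+f^{56})$. $\mathrm{d}$ is the Chevalley-Eilenberg differential ($\mathrm{d}\alpha(x,y)=-\alpha([x,y])$ for $\alpha\in\mathfrak{n}^*$, extended as a graded derivation of $\Lambda^\bullet\mathfrak{n}^*$). A nilsoliton metric on a nilpotent Lie algebra $\mathfrak{n}$ is an inner product $g$ whose Ricci endomorphism (that of the corresponding left-invariant Riemannian metric on the simply connected Lie group with Lie algebra $\mathfrak{n}$) is of the form $\mathrm{Rc}(g)=\lambda\,\mathrm{Id}+D$ for some $\lambda\in\mathbb{R}$ and some derivation $D$ of $\mathfrak{n}$; it is known to be unique up to automorphism and scaling when it exists. A $\mathrm{G}_2$-structure on a $7$-dimensional real vector space $V$ is a $3$-form $\varphi\in\Lambda^3V^*$ such that $(v\lrcorner\varphi)\wedge(v\lrcorner\varphi)\wedge\varphi\neq0$ for all $v\in V\smallsetminus\{0\}$. It determines a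 unique inner product $g_\varphi$ and orientation, with volume form $\mathrm{vol}_\varphi$, such that $g_\varphi(v,w)\mathrm{vol}_\varphi=\frac16\,(v\lrcorner\varphi)\wedge(w\lrcorner\varphi)\wedge\varphi$; $*_\varphi$ is the corresponding Hodge operator. $\varphi$ induces $g$ if $g_\varphi=g$. A $\mathrm{G}_2$-structure $\varphi$ on $\mathfrak{n}$ is purely coclosed if $\mathrm{d}*_\varphi\varphi=0$ and $\mathrm{d}\varphi\wedge\varphi=0$. *)

(* Defs.v *)
From HB Require Import structures.
From mathcomp Require Import all_boot all_order all_algebra all_fingroup.
From mathcomp Require Import reals ring.
Set Implicit Arguments.
Unset Strict Implicit.
Unset Printing Implicit Defensive.
Import Order.TTheory GRing.Theory Num.Theory.
Local Open Scope ring_scope.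

(** * Lie algebras on coordinate spaces *)

(* Linearity in the second argument follows from antisymmetry. *)
Record lieAlgebra (R : realType) (n : nat) := LieAlgebra {
  bracket :> 'rV[R]_n -> 'rV[R]_n -> 'rV[R]_n;
  bracket_linearl : forall (a : R) x y z,
    bracket (a *: x + y) z = a *: bracket x z + bracket y z;
  bracket_alt : forall x, bracket x x = 0;
  bracket_jacobi : forall x y z,
    bracket x (bracket y z) + bracket y (bracket z x)
      + bracket z (bracket x y) = 0 }.

(* Endomorphisms are matrices acting on row vectors on the right. *)
Definition derivation (R : realType) n (L : lieAlgebra R n) (D : 'M[R]_n) :=
  forall x y, L x y *m D = L (x *m D) y + L x (y *m D).

(** * Exterior forms *)

(* A k-form is evaluated on the k rows of a matrix. *)
Definition kform (R : realType) (n k : nat) := 'M[R]_(k, n) -> R.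

(* Same formulation as [determinant_multilinear] and [determinant_alternate]. *)
Definition is_alternating (R : realType) n k (f : kform R n k) :=
  (forall (A B C : 'M_(k, n)) i (b c : R),
     row i A = b *: row i B + c *: row i C ->
     row' i B = row' i A -> row' i C = row' i A ->
     f A = b * f B + c * f C) /\
  (forall (A : 'M_(k, n)) i j, i != j -> row i A = row j A -> f A = 0).

(* Normalised so that (a /\ b)(x, y) = a(x) b(y) - a(y) b(x) on 1-forms. *)
Definition wedge (R : realType) n k l (a : kform R n k) (b : kform R n l) :
    kform R n (k + l) := fun M =>
  (k`! * l`!)%:R^-1 * \sum_(s : 'S_(k + l))
    (-1) ^+ s * a (usubmx (row_perm s M)) * b (dsubmx (row_perm s M)).

Definition interior (R : realType) n k (v : 'rV[R]_n) (a : kform R n (1 + k)) :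
    kform R n k := fun M => a (col_mx v M).

(* d a (x_0, .., x_k) =
     \sum_(i < j) (-1)^(i + j) a ([x_i, x_j], x_0, .., ^x_i, .., ^x_j, .., x_k);
   for i < j, the row x_i of M is the row i of [row' j M]. *)
Definition ce_diff (R : realType) n k (L : lieAlgebra R n)
    (a : kform R n k.+1) : kform R n k.+2 := fun M =>
  \sum_(j < k.+2) \sum_(i < k.+1 | (i < j)%N)
    (-1) ^+ (i + j) *
    a (col_mx (L (row i (row' j M)) (row j M)) (row' i (row' j M))).

Lemma ce_diff1E (R : realType) n (L : lieAlgebra R n) (a : kform R n 1)
    (x y : 'rV[R]_n) :
  ce_diff L a (@col_mx R 1 1 n x y) = - a (L x y).
Proof.
rewrite /ce_diff big_ord_recl big_pred0 // add0r big_ord1.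
rewrite (big_pred1 ord0) => [|i]; last by rewrite ord1.
rewrite expr1 mulN1r; congr (- a _).
have -> : row ord0 (row' (lift ord0 ord0) (@col_mx R 1 1 n x y)) = x.
  apply/rowP => j; rewrite 2!mxE -[RHS](@col_mxEu R 1 1 n x y).
  by congr (col_mx x y _ j); apply: val_inj.
have -> : row (lift ord0 ord0) (@col_mx R 1 1 n x y) = y.
  apply/rowP => j; rewrite mxE -[RHS](@col_mxEd R 1 1 n x y).
  by congr (col_mx x y _ j); apply: val_inj.
apply/rowP => j.
rewrite -[RHS](col_mxEu _ (row' ord0 (row' (lift ord0 ord0) (@col_mx R 1 1 n x y)))).
by congr (col_mx _ _ _ j); apply: val_inj.
Qed.

(** * Inner products, represented by their Gram matrices *)

Definition dot (R : realType) n (G : 'M[R]_n) (x y : 'rV[R]_n) : R :=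
  (x *m G *m y^T) 0 0.

Definition inner_product (R : realType) n (G : 'M[R]_n) :=
  G^T = G /\ forall x : 'rV[R]_n, x != 0 -> 0 < dot G x x.

(* The orientation is the sign (-1)^o of the standard basis. *)
Definition volume (R : realType) n (G : 'M[R]_n) (o : bool) : kform R n n :=
  fun M => (-1) ^+ o * Num.sqrt (\det G) * \det M.

(* In index notation,
     ( *a)_(j_1..j_l) = 1/k! a_(i_1..i_k) g^(i_1 m_1) .. g^(i_k m_k)
                          vol_(m_1..m_k j_1..j_l),
   so that b /\ *a = <b, a> vol; the i-th row of the inverse Gram matrix is the
   metric dual of the i-th coordinate form. *)
Definition hodge (R : realType) k l (G : 'M[R]_(k + l)) (o : bool)
    (a : kform R (k + l) k) : kform R (k + l) l := fun M =>
  k`!%:R^-1 * \sum_(f : {ffun 'I_k -> 'I_(k + l)})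
    a (rowsub f 1%:M) * volume G o (col_mx (rowsub f (invmx G)) M).

(** * Ricci curvature of a left-invariant metric *)

(* Koszul formula for left-invariant vector fields: [u *m G] has entries
   g(u, e_k). *)
Definition levi_civita (R : realType) n (L : lieAlgebra R n) (G : 'M[R]_n)
    (x y : 'rV[R]_n) : 'rV[R]_n :=
  (\row_k (2^-1 * (dot G (L x y) (delta_mx 0 k)
                   - dot G (L y (delta_mx 0 k)) x
                   + dot G (L (delta_mx 0 k) x) y))) *m invmx G.

Definition curvature (R : realType) n (L : lieAlgebra R n) (G : 'M[R]_n)
    (x y z : 'rV[R]_n) : 'rV[R]_n :=
  let nabla := levi_civita L G in
  nabla x (nabla y z) - nabla y (nabla x z) - nabla (L x y) z.

(* ric(x, y) is the trace of z |-> R(z, x) y. *)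
Definition ricci (R : realType) n (L : lieAlgebra R n) (G : 'M[R]_n)
    (x y : 'rV[R]_n) : R :=
  \sum_k curvature L G (delta_mx 0 k) x y 0 k.

(* g(Rc x, y) = ric(x, y). *)
Definition ricci_endo (R : realType) n (L : lieAlgebra R n) (G : 'M[R]_n) :
    'M[R]_n :=
  (\matrix_(i, j) ricci L G (delta_mx 0 i) (delta_mx 0 j)) *m invmx G.

Definition nilsoliton (R : realType) n (L : lieAlgebra R n) (G : 'M[R]_n) :=
  inner_product G /\
  exists (lambda : R) (D : 'M[R]_n),
    derivation L D /\ ricci_endo L G = lambda%:M + D.

(** * G2-structures *)

Definition g2_bilin (R : realType) (phi : kform R 7 3) (v w : 'rV[R]_7) :
    kform R 7 7 :=
  wedge (wedge (interior v (phi : kform R 7 (1 + 2)))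
               (interior w (phi : kform R 7 (1 + 2)))) phi.

Definition g2_structure (R : realType) (phi : kform R 7 3) :=
  is_alternating phi /\
  forall v : 'rV[R]_7, v != 0 -> exists M, g2_bilin phi v v M != 0.

(* G and o are the inner product and the orientation determined by phi. *)
Definition g2_compatible (R : realType) (phi : kform R 7 3) (G : 'M[R]_7)
    (o : bool) :=
  inner_product G /\
  forall v w M, dot G v w * volume G o M = 6^-1 * g2_bilin phi v w M.

Lemma g2_compatible_unique (R : realType) (phi : kform R 7 3) G o G' o' :
  g2_structure phi -> g2_compatible phi G o -> g2_compatible phi G' o' ->
  G = G' /\ o = o'.
Proof.
move=> [_ nd] [_ E] [_ E'].
pose c := (-1) ^+ o * Num.sqrt (\det G); pose c' := (-1) ^+ o' * Num.sqrt (\det G').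
have dotE (H : 'M[R]_7) i j : dot H (delta_mx 0 i) (delta_mx 0 j) = H i j.
  by rewrite /dot -rowE trmx_delta -colE !mxE.
have eqG : c *: G = c' *: G'.
  apply/matrixP => i j; rewrite !mxE -!(dotE _ i j).
  have := E (delta_mx 0 i) (delta_mx 0 j) 1%:M.
  by rewrite -E' /volume !det1 !mulr1 mulrC => ->; rewrite mulrC.
have v0 : (delta_mx 0 0 : 'rV[R]_7) != 0.
  by apply/eqP => /matrixP/(_ 0 0)/eqP; rewrite !mxE !eqxx oner_eq0.
have sgn (b : bool) : ((-1) ^+ b : R) ^+ 2 = 1 by rewrite sqrr_sign.
have sq (H : 'M[R]_7) b : (forall v w M, dot H v w * volume H b M
    = 6^-1 * g2_bilin phi v w M) -> 0 < \det H.
  move=> EH; have [M] := nd _ v0; apply: contraNT; rewrite -leNgt => /ler0_sqrtr H0.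
  have := EH (delta_mx 0 0) (delta_mx 0 0) M.
  rewrite /volume H0 mulr0 mul0r mulr0 => /esym/eqP.
  by rewrite mulf_eq0 invr_eq0 pnatr_eq0.
have dG := sq _ _ E; have dG' := sq _ _ E'.
have c2 : c ^+ 2 = \det G by rewrite exprMn sgn mul1r sqr_sqrtr ?ltW.
have c2' : c' ^+ 2 = \det G' by rewrite exprMn sgn mul1r sqr_sqrtr ?ltW.
have c9 : c ^+ 9 = c' ^+ 9.
  have := congr1 determinant eqG.
  by rewrite !detZ -c2 -c2' -!exprD.
have s9 (b : bool) : ((-1) ^+ b : R) ^+ 9 = (-1) ^+ b.
  by case: b; rewrite ?expr0 ?expr1n // expr1 -[LHS]signr_odd.
have p (H : 'M[R]_7) : 0 < \det H -> 0 < Num.sqrt (\det H) by rewrite sqrtr_gt0.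
have eo : o = o'.
  have /(congr1 (fun x => x < 0)) := c9.
  rewrite !exprMn !s9.
  have g H : 0 < \det H -> 0 < Num.sqrt (\det (H : 'M[R]_7)) ^+ 9.
    by move=> h; rewrite exprn_gt0 ?p.
  by rewrite ![_ ^+ _ * _ < 0]pmulr_llt0 ?g //; case: (o) (o') => -[];
    rewrite ?ltrN10 ?ltr10.
have ec : c = c'.
  move: c9; rewrite /c /c' eo !exprMn s9 => /(mulfI (negbT (signr_eq0 R o'))) /eqP.
  by rewrite eqrXn2 ?sqrtr_ge0 // => /eqP ->.
split=> //; move: eqG; rewrite -ec; apply: scalerI.
by apply/eqP => h; move: dG; rewrite -c2 h expr0n ltxx.
Qed.

Definition g2_induces (R : realType) (phi : kform R 7 3) (G : 'M[R]_7) :=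
  exists o, g2_compatible phi G o.

(* The pair (G, o) is unique by [g2_compatible_unique]. *)
Definition purely_coclosed (R : realType) (L : lieAlgebra R 7)
    (phi : kform R 7 3) :=
  [/\ g2_structure phi,
      exists G o, g2_compatible phi G o /\
        forall M, ce_diff L (@hodge R 3 4 G o phi) M = 0
    & forall M, wedge (ce_diff L phi) phi M = 0].

(** * The Lie algebras h_5 + R^2 and h_7 *)

(* f i is the i-th coordinate form, with i counted from 1. *)
Definition f1 (R : realType) (i : nat) (x : 'rV[R]_7) : R := x 0 (inord i.-1).

Definition f2 (R : realType) (i j : nat) (x y : 'rV[R]_7) : R :=
  f1 i x * f1 j y - f1 i y * f1 j x.

(* The bracket with d f^i = 0 for i < 7 and d f^7 = w, i.e.
   f^7([x, y]) = - w(x, y). *)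
Definition central_bracket (R : realType) (w : 'rV[R]_7 -> 'rV[R]_7 -> R)
    (x y : 'rV[R]_7) : 'rV[R]_7 :=
  \row_(i < 7) (if i == ord_max then - w x y else 0).

Definition w_h5R2 (R : realType) (x y : 'rV[R]_7) : R := f2 1 2 x y + f2 3 4 x y.

Definition w_h7 (R : realType) (x y : 'rV[R]_7) : R :=
  f2 1 2 x y + f2 3 4 x y + f2 5 6 x y.

Lemma f1_lin (R : realType) i (a : R) (x y : 'rV[R]_7) :
  f1 i (a *: x + y) = a * f1 i x + f1 i y.
Proof. by rewrite /f1 !mxE. Qed.

Lemma f2_lin (R : realType) i j (a : R) (x y z : 'rV[R]_7) :
  f2 i j (a *: x + y) z = a * f2 i j x z + f2 i j y z.
Proof.
by rewrite /f2 !f1_lin; ring.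
Qed.

Lemma f2_alt (R : realType) i j (x : 'rV[R]_7) : f2 i j x x = 0.
Proof. by rewrite /f2 subrr. Qed.

Lemma f1_central (R : realType) w (i : nat) (x y : 'rV[R]_7) :
  (0 < i < 7)%N -> f1 i (central_bracket w x y) = 0.
Proof.
case: i => [//|i] /andP[_ i6]; rewrite /f1 mxE ifN //.
apply/eqP => /(congr1 (@nat_of_ord 7)); rewrite inordK ?(ltn_trans _ i6) //.
by move=> /= e; rewrite e in i6.
Qed.

Lemma f2_central (R : realType) w (i j : nat) (x y z : 'rV[R]_7) :
  (0 < i < 7)%N -> (0 < j < 7)%N -> f2 i j x (central_bracket w y z) = 0.
Proof. by move=> hi hj; rewrite /f2 !f1_central // mulr0 mul0r subrr. Qed.

Lemma central_bracket_lin (R : realType) (w : 'rV[R]_7 -> 'rV[R]_7 -> R)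
    (wl : forall a x y z, w (a *: x + y) z = a * w x z + w y z) a x y z :
  central_bracket w (a *: x + y) z =
  a *: central_bracket w x z + central_bracket w y z.
Proof.
apply/rowP => i; rewrite !mxE wl; case: ifP => _; last by rewrite mulr0 addr0.
by rewrite opprD mulrN.
Qed.

Lemma central_bracket0 (R : realType) (w : 'rV[R]_7 -> 'rV[R]_7 -> R) x y :
  w x y = 0 -> central_bracket w x y = 0.
Proof. by move=> w0; apply/rowP => i; rewrite !mxE w0 oppr0 if_same. Qed.

Lemma central_bracket_jacobi (R : realType) (w : 'rV[R]_7 -> 'rV[R]_7 -> R)
    (wc : forall x y z, w x (central_bracket w y z) = 0) x y z :
  let b := central_bracket w in b x (b y z) + b y (b z x) + b z (b x y) = 0.
Proof. by rewrite /= !(@central_bracket0 _ w _ (central_bracket _ _ _)) // !addr0. Qed.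

Lemma w_h5R2_lin (R : realType) (a : R) (x y z : 'rV[R]_7) :
  w_h5R2 (a *: x + y) z = a * w_h5R2 x z + w_h5R2 y z.
Proof. by rewrite /w_h5R2 !f2_lin; ring. Qed.

Lemma w_h7_lin (R : realType) (a : R) (x y z : 'rV[R]_7) :
  w_h7 (a *: x + y) z = a * w_h7 x z + w_h7 y z.
Proof. by rewrite /w_h7 !f2_lin; ring. Qed.

Lemma w_h5R2_alt (R : realType) (x : 'rV[R]_7) : w_h5R2 x x = 0.
Proof. by rewrite /w_h5R2 !f2_alt addr0. Qed.

Lemma w_h7_alt (R : realType) (x : 'rV[R]_7) : w_h7 x x = 0.
Proof. by rewrite /w_h7 !f2_alt !addr0. Qed.

Lemma w_h5R2_central (R : realType) w (x y z : 'rV[R]_7) :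
  w_h5R2 x (central_bracket w y z) = 0.
Proof. by rewrite /w_h5R2 !f2_central // addr0. Qed.

Lemma w_h7_central (R : realType) w (x y z : 'rV[R]_7) :
  w_h7 x (central_bracket w y z) = 0.
Proof. by rewrite /w_h7 !f2_central // !addr0. Qed.

(* (0, 0, 0, 0, 0, 0, f^12 + f^34) *)
Definition h5R2 (R : realType) : lieAlgebra R 7 :=
  LieAlgebra (central_bracket_lin (@w_h5R2_lin R))
    (fun x => central_bracket0 (w_h5R2_alt x))
    (central_bracket_jacobi (@w_h5R2_central R _)).

(* (0, 0, 0, 0, 0, 0, f^12 + f^34 + f^56) *)
Definition h7 (R : realType) : lieAlgebra R 7 :=
  LieAlgebra (central_bracket_lin (@w_h7_lin R))
    (fun x => central_bracket0 (w_h7_alt x))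
    (central_bracket_jacobi (@w_h7_central R _)).

(* Main.v *)
(* Both algebras have [x, y] = - omega(x, y) e with e central. For such a bracket
   and an inner product G, let J be the endomorphism representing omega. A direct
   computation of the Ricci tensor shows that G is a nilsoliton iff J^3 is a
   multiple of J; on h_7, where omega is nondegenerate modulo e, this says that
   J^2 is scalar on the orthogonal complement U of e.

   Write phi = eta /\ sigma + rho with eta the metric dual of e (normalised) and
   sigma, rho forms on U. Let K be Hitchin's endomorphism of U attached to rho,
   quadratic in rho; K^2 is always scalar. That phi induces G forces sigma^3 <> 0,
   sigma /\ rho = 0 and sigma K = const Id, so sigma, K and a complex structure
   are proportional. Since d eta = omega up to scale and all forms on U are closed,
   d * phi = 0 says that omega contracts to 0 with rho, which makes K J symmetric,
   i.e. J commutes with sigma; and d phi /\ phi = 0 says omega /\ sigma^2 = 0, i.e.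
   tr (J sigma) = 0. If J^2 is scalar then J sigma is symmetric with scalar square,
   and its two eigenspaces, stable under the complex structure sigma, are of even
   dimension; as dim U = 6 its trace does not vanish, a contradiction. On
   h_5 + R^2 one has instead J^2 = - Id on a 4-dimensional subspace and J = 0 on
   its complement, and an explicit form on the standard frame works. *)
Require Import Defs.
From mathcomp Require Import all_boot all_order all_algebra all_fingroup.
From mathcomp Require Import reals ring.
Set Implicit Arguments.
Unset Strict Implicit.
Unset Printing Implicit Defensive.
Import Order.TTheory GRing.Theory Num.Theory.
Local Open Scope ring_scope.

(** * Alternating forms *)

(** Rows are compared one at a time instead of through [row'], so that the hypotheses pass easily
    through permuting, stacking and multiplying matrices. *)
Definition multilin (R : realType) n k (f : kform R n k) :=
  forall (A B C : 'M_(k, n)) i (b c : R),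
    row i A = b *: row i B + c *: row i C ->
    (forall j, j != i -> row j B = row j A) ->
    (forall j, j != i -> row j C = row j A) ->
    f A = b * f B + c * f C.

Lemma multilinP (R : realType) n k (f : kform R n k) :
  is_alternating f <->
  multilin f /\ forall (A : 'M_(k, n)) i j, i != j -> row i A = row j A -> f A = 0.
Proof.
split=> -[lin alt]; split=> // A B C i b c rA eB eC.
  by apply: (lin _ _ _ i) => //; apply/row_matrixP => j; apply/rowP => l;
    [move: (eB (lift i j)) | move: (eC (lift i j))]; rewrite eq_sym neq_lift => /(_ isT);
    move=> /rowP/(_ l); rewrite !mxE.
by apply: (lin _ _ _ i) => // j ji; apply/rowP => l; rewrite !mxE;
  [apply: (row'_eq eB) | apply: (row'_eq eC)]; rewrite inE.
Qed.

Lemma eq_alternating (R : realType) n k (f g : kform R n k) :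
  (forall M, f M = g M) -> is_alternating g -> is_alternating f.
Proof.
move=> e /multilinP[lin alt]; apply/multilinP; split=> [A B C i b c rA eB eC | A i j ij rij].
  by rewrite !e; apply: lin rA eB eC.
by rewrite e; apply: alt ij rij.
Qed.

Lemma det_alternating (R : realType) n : is_alternating (fun M : 'M[R]_n => \det M).
Proof.
apply/multilinP; split=> [A B C i b c rA eB eC | A i j ij rij].
  apply: (determinant_multilinear rA); apply/row_matrixP => j; rewrite !row_rowsub.
    by apply: eB; rewrite eq_sym neq_lift.
  by apply: eC; rewrite eq_sym neq_lift.
by apply: (determinant_alternate ij) => q; move/rowP: rij => /(_ q); rewrite !mxE.
Qed.

Lemma volume_alt (R : realType) n (G : 'M[R]_n) o : is_alternating (volume G o).
Proof.
have /multilinP[lin alt] := @det_alternating R n; apply/multilinP; rewrite /volume.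
split=> [A B C i b c rA eB eC | A i j ij rij]; last by rewrite (alt _ _ _ ij rij) mulr0.
by rewrite (lin _ _ _ _ _ _ rA eB eC) mulrDr; congr (_ + _); rewrite mulrCA.
Qed.

Section AlternatingForms.
Variables (R : realType) (n : nat).

Lemma alternating_sum k (I : finType) (c : I -> R) (F : I -> kform R n k) :
  (forall i, is_alternating (F i)) -> is_alternating (fun M => \sum_i c i * F i M).
Proof.
move=> Falt; apply/multilinP; split=> [A B C i b d rA eB eC | A i j ij rij].
  rewrite !mulr_sumr -big_split; apply: eq_bigr => q _ /=.
  have /multilinP[lin _] := Falt q.
  by rewrite (lin _ _ _ _ _ _ rA eB eC) mulrDr; congr (_ + _); rewrite mulrCA.
apply: big1 => q _; have /multilinP[_ alt] := Falt q.
by rewrite (alt _ _ _ ij rij) mulr0.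
Qed.

Lemma mulmxr_alt k m (f : kform R n k) (X : 'M[R]_(m, n)) :
  is_alternating f -> is_alternating (fun M : 'M_(k, m) => f (M *m X)).
Proof.
move=> /multilinP[lin alt]; apply/multilinP; split=> [A B C i b c rA eB eC | A i j ij rij].
  apply: (lin _ _ _ i); rewrite ?row_mul ?rA ?mulmxDl ?scalemxAl // => j ji.
    by rewrite !row_mul eB.
  by rewrite !row_mul eC.
by apply: (alt _ i j ij); rewrite !row_mul rij.
Qed.

Lemma prepend_alt k m (f : kform R n (m + k)) (X : 'M_(m, n)) :
  is_alternating f -> is_alternating (fun N : 'M_(k, n) => f (col_mx X N)).
Proof.
move=> /multilinP[lin alt]; apply/multilinP.
have r D j : row (rshift m j) (col_mx X D) = row j D.
  by apply/rowP => q; rewrite !mxE (unsplitK (inr j)).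
have rX D j : row (lshift k j) (col_mx X D) = row j X.
  by apply/rowP => q; rewrite !mxE (unsplitK (inl j)).
split=> [A B C i b c rA eB eC | A i j ij rij].
  apply: (lin _ _ _ (rshift m i)); rewrite ?r // => j.
    by case: (split_ordP j) => q ->; rewrite ?r ?rX // (inj_eq (@rshift_inj _ _)) => /eB.
  by case: (split_ordP j) => q ->; rewrite ?r ?rX // (inj_eq (@rshift_inj _ _)) => /eC.
by apply: (alt _ (rshift m i) (rshift m j)); rewrite ?r // (inj_eq (@rshift_inj _ _)).
Qed.

Lemma append_alt k m (f : kform R n (k + m)) (X : 'M_(m, n)) :
  is_alternating f -> is_alternating (fun N : 'M_(k, n) => f (col_mx N X)).
Proof.
move=> /multilinP[lin alt]; apply/multilinP.
have r D j : row (lshift m j) (col_mx D X) = row j D.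
  by apply/rowP => q; rewrite !mxE (unsplitK (inl j)).
have rX D j : row (rshift k j) (col_mx D X) = row j X.
  by apply/rowP => q; rewrite !mxE (unsplitK (inr j)).
split=> [A B C i b c rA eB eC | A i j ij rij].
  apply: (lin _ _ _ (lshift m i)); rewrite ?r // => j.
    by case: (split_ordP j) => q ->; rewrite ?r ?rX // (inj_eq (@lshift_inj _ _)) => /eB.
  by case: (split_ordP j) => q ->; rewrite ?r ?rX // (inj_eq (@lshift_inj _ _)) => /eC.
by apply: (alt _ (lshift m i) (lshift m j)); rewrite ?r // (inj_eq (@lshift_inj _ _)).
Qed.

Lemma interior_alt k (v : 'rV[R]_n) (f : kform R n (1 + k)) :
  is_alternating f -> is_alternating (interior v f).
Proof. exact: prepend_alt. Qed.

(** Linearity: after the permutation, row i lies in exactly one of the two blocks. Alternation: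
    composing s with the transposition of two equal rows only changes its sign, so the sum is its
    own opposite. *)
Lemma wedge_alt k l (a : kform R n k) (b : kform R n l) :
  is_alternating a -> is_alternating b -> is_alternating (wedge a b).
Proof.
move=> /multilinP[alin aalt] /multilinP[blin balt]; apply/multilinP; split.
  move=> A B C i x y rA eB eC.
  rewrite /wedge mulrCA [y * _]mulrCA -mulrDr; congr (_ * _).
  rewrite !mulr_sumr -big_split; apply: eq_bigr => s _ /=.
  have ru D j : row j (usubmx (row_perm s D)) = row (s (lshift l j)) D.
    by apply/rowP => m; rewrite !mxE.
  have rd D j : row j (dsubmx (row_perm s D)) = row (s (rshift k j)) D.
    by apply/rowP => m; rewrite !mxE.
  have [p] : exists p, i = s p by exists (s^-1 i)%g; rewrite permKV.
  case: (split_ordP p) => q -> iE; subst i.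
    have aE : a (usubmx (row_perm s A)) = x * a (usubmx (row_perm s B))
         + y * a (usubmx (row_perm s C)).
      apply: (alin _ _ _ q); rewrite ?ru // => j jq; rewrite !ru.
        by apply: eB; rewrite (inj_eq perm_inj) (inj_eq (@lshift_inj _ _)).
      by apply: eC; rewrite (inj_eq perm_inj) (inj_eq (@lshift_inj _ _)).
    have dB : dsubmx (row_perm s B) = dsubmx (row_perm s A).
      by apply/row_matrixP => j; rewrite !rd eB // (inj_eq perm_inj) eq_rlshift.
    have dC : dsubmx (row_perm s C) = dsubmx (row_perm s A).
      by apply/row_matrixP => j; rewrite !rd eC // (inj_eq perm_inj) eq_rlshift.
    by rewrite aE dB dC mulrDr mulrDl; congr (_ + _); rewrite mulrCA -!mulrA.
  have bE : b (dsubmx (row_perm s A)) = x * b (dsubmx (row_perm s B))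
       + y * b (dsubmx (row_perm s C)).
    apply: (blin _ _ _ q); rewrite ?rd // => j jq; rewrite !rd.
      by apply: eB; rewrite (inj_eq perm_inj) (inj_eq (@rshift_inj _ _)).
    by apply: eC; rewrite (inj_eq perm_inj) (inj_eq (@rshift_inj _ _)).
  have dB : usubmx (row_perm s B) = usubmx (row_perm s A).
    by apply/row_matrixP => j; rewrite !ru eB // (inj_eq perm_inj) eq_lrshift.
  have dC : usubmx (row_perm s C) = usubmx (row_perm s A).
    by apply/row_matrixP => j; rewrite !ru eC // (inj_eq perm_inj) eq_lrshift.
  by rewrite bE dB dC mulrDr; congr (_ + _); rewrite mulrCA.
move=> A i j ij rij; rewrite /wedge.
set S := \sum_s _; suff S0 : S = 0 by rewrite S0 mulr0.
have : S = - S.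
  rewrite {1}/S (reindex_inj (mulIg (tperm i j))) -sumrN; apply: eq_bigr => s _.
  have -> : row_perm (s * tperm i j)%g A = row_perm s A.
    apply/matrixP => p q; rewrite !mxE permM; move/rowP: rij => /(_ q) /[!mxE] rij.
    by case: tpermP => // ->.
  by rewrite odd_permM odd_tperm ij addbT signrN !mulNr.
by move/eqP; rewrite -addr_eq0 -mulr2n mulrn_eq0 => /eqP.
Qed.

Lemma sum_ffun_recl (T : finType) k (F : {ffun 'I_k.+1 -> T} -> R) :
  \sum_g F g =
  \sum_x \sum_(g : {ffun 'I_k -> T}) F [ffun i => oapp g x (unlift ord0 i)].
Proof.
rewrite pair_big /=.
rewrite (reindex (fun p : T * {ffun 'I_k -> T} =>
  [ffun i => oapp p.2 p.1 (unlift ord0 i)])) //=.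
exists (fun g : {ffun 'I_k.+1 -> T} => (g ord0, [ffun i => g (lift ord0 i)])).
  move=> [x g] _ /=; rewrite ffunE unlift_none /=; congr (_, _).
  by apply/ffunP => i; rewrite !ffunE liftK.
by move=> g _; apply/ffunP => i; rewrite !ffunE; case: unliftP => [j|] -> //=; rewrite ffunE.
Qed.

Lemma multilin_sum k (f : kform R n k) (I : finType) (c : I -> R)
    (N : I -> 'M_(k, n)) (A : 'M_(k, n)) i :
  is_alternating f -> row i A = \sum_j c j *: row i (N j) ->
  (forall j l, l != i -> row l (N j) = row l A) ->
  f A = \sum_j c j * f (N j).
Proof.
move=> /multilinP[lin _].
pose upd (v : 'rV[R]_n) : 'M_(k, n) := \matrix_l (if l == i then v else row l A).
have ru v : row i (upd v) = v by rewrite rowK eqxx.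
have ruN v l : l != i -> row l (upd v) = row l A by rewrite rowK => /negPf->.
have updE M : (forall l, l != i -> row l M = row l A) -> M = upd (row i M).
  move=> e; apply/row_matrixP => l; have [->|li] := eqVneq l i; first by rewrite ru.
  by rewrite ruN ?e.
move=> rA eN; rewrite (updE A) // rA.
under [RHS]eq_bigr => j _ do rewrite (updE (N j) (eN j)).
elim: (index_enum I) => [|j s IH].
  (* The empty sum requires f to vanish on a zero row: linearity with both coefficients 0. *)
  rewrite !big_nil (lin _ (upd 0) (upd 0) i 0 0) ?mul0r ?addr0 //.
  by rewrite !ru !scaler0 addr0.
rewrite !big_cons (lin _ (upd (row i (N j))) (upd (\sum_(j <- s) c j *: row i (N j))) i (c j) 1).
- by rewrite IH mul1r.
- by rewrite !ru scale1r.
- by move=> l li; rewrite !ruN.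
- by move=> l li; rewrite !ruN.
Qed.

Lemma interior_sum k (f : kform R n (1 + k)) (v : 'rV_n) M : is_alternating f ->
  interior v f M = \sum_a v 0 a * interior (row a 1%:M) f M.
Proof.
move=> falt; rewrite /interior.
have r0 u : row (lshift k ord0) (col_mx u M) = u by apply/rowP => q; rewrite mxE col_mxEu.
apply: (@multilin_sum _ f _ (fun a => v 0 a) (fun a => col_mx (row a 1%:M) M) _
  (lshift k ord0)) => //.
  rewrite r0 {1}[v]row_sum_delta; apply: eq_bigr => a _; by rewrite r0 row1.
move=> a l; case: (split_ordP l) => q ->; first by rewrite ord1 eqxx.
by move=> _; apply/rowP => q'; rewrite !mxE (unsplitK (inr q)).
Qed.

(** Induction on k: the first row is expanded by linearity, the others by the induction hypothesis
    for the interior product with a row of B. *)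
Lemma multilin_expand k m (f : kform R n k) (A : 'M[R]_(k, m)) (B : 'M[R]_(m, n)) :
  is_alternating f ->
  f (A *m B) =
  \sum_(g : {ffun 'I_k -> 'I_m}) (\prod_i A i (g i)) * f (rowsub g B).
Proof.
elim: k f A => [|k IH] f A falt.
  rewrite (big_pred1 (ffun0 (card_ord 0))).
    by rewrite big_ord0 mul1r; congr f; apply/matrixP => -[].
  by move=> g; apply/esym/eqP/ffunP => -[].
pose N j : 'M_(1 + k, n) := col_mx (row j B) (row' ord0 A *m B).
have N0 j : row ord0 (N j : 'M_(k.+1, n)) = row j B.
  apply/rowP => l; rewrite [LHS]mxE -[RHS](col_mxEu _ (row' ord0 A *m B)).
  by congr (N j _ _); apply: val_inj.
have NS j i : row (lift ord0 i) (N j : 'M_(k.+1, n)) = row (lift ord0 i) A *m B.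
  apply/rowP => l; rewrite [LHS]mxE -row_mul.
  transitivity ((row' ord0 A *m B) i l); last first.
    by rewrite !mxE; apply: eq_bigr => q _; rewrite !mxE.
  by rewrite -[RHS](col_mxEd (row j B)); congr (N j _ _); apply: val_inj.
rewrite (@multilin_sum _ f _ (A ord0) N _ ord0) //; first last.
- by move=> j l; case: (unliftP ord0 l) => [q|] -> //; rewrite NS row_mul.
- rewrite row_mul mulmx_sum_row; apply: eq_bigr => j _.
  by rewrite N0 !mxE.
rewrite sum_ffun_recl; apply: eq_bigr => j _.
transitivity (A ord0 j * interior (row j B) (f : kform R n (1 + k)) (row' ord0 A *m B)) => //.
rewrite IH; last exact: interior_alt.
rewrite mulr_sumr; apply: eq_bigr => g _; rewrite big_ord_recl ffunE unlift_none mulrA.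
congr (_ * _ * _).
  by apply: eq_bigr => i _; rewrite !ffunE liftK !mxE.
rewrite /interior; congr f; apply/matrixP => i l; rewrite [RHS]mxE ffunE.
case: (unliftP ord0 i) => [q|] -> /=.
  transitivity (rowsub g B q l); last by rewrite mxE.
  rewrite -[RHS](col_mxEd (row j B) (rowsub g B)).
  by congr (col_mx _ _ _ _); apply: val_inj.
transitivity (row j B ord0 l); last by rewrite mxE.
rewrite -(col_mxEu (row j B) (rowsub g B)).
by congr (col_mx _ _ _ _); apply: val_inj.
Qed.

(* P^T P is the inverse Gram matrix for which P is orthonormal: contracting with
   the metric amounts to summing over P. *)
Lemma alt_contraction k m (a b : kform R n k) (P : 'M[R]_(m, n)) :
  is_alternating a -> is_alternating b ->
  \sum_(f : {ffun 'I_k -> 'I_n}) a (rowsub f 1%:M) * b (rowsub f P^T *m P) =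
  \sum_(g : {ffun 'I_k -> 'I_m}) a (rowsub g P) * b (rowsub g P).
Proof.
move=> aa ba.
under eq_bigr => f _ do rewrite (multilin_expand _ _ ba) mulr_sumr.
rewrite exchange_big; apply: eq_bigr => g _ /=.
rewrite -[X in a X * _]mulmx1 (multilin_expand _ _ aa) mulr_suml; apply: eq_bigr => f _.
rewrite mulrA; congr (_ * _); rewrite mulrC; congr (_ * _).
by apply: eq_bigr => i _; rewrite !mxE.
Qed.
End AlternatingForms.

(** * Bilinear forms given by matrices *)

Section Dot.
Variables (R : realType) (n : nat).
Implicit Types (M : 'M[R]_n) (x y z : 'rV[R]_n).

Lemma dotDl M x y z : dot M (x + y) z = dot M x z + dot M y z.
Proof. by rewrite /dot !mulmxDl mxE. Qed.

Lemma dotDr M x y z : dot M x (y + z) = dot M x y + dot M x z.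
Proof. by rewrite /dot linearD mulmxDr mxE. Qed.

Lemma dotZl M a x y : dot M (a *: x) y = a * dot M x y.
Proof. by rewrite /dot -!scalemxAl mxE. Qed.

Lemma dotZr M a x y : dot M x (a *: y) = a * dot M x y.
Proof. by rewrite /dot linearZ -scalemxAr mxE. Qed.

Lemma dot_tr M x y : dot M^T x y = dot M y x.
Proof.
rewrite /dot; have -> : x *m M^T *m y^T = (y *m M *m x^T)^T.
  by rewrite !trmx_mul trmxK mulmxA.
by rewrite mxE.
Qed.

Lemma dot_delta M i j : dot M (delta_mx 0 i) (delta_mx 0 j) = M i j.
Proof. by rewrite /dot -rowE trmx_delta -colE !mxE. Qed.

Lemma dot_deltar M x j : dot M x (delta_mx 0 j) = (x *m M) 0 j.
Proof. by rewrite /dot trmx_delta -colE !mxE. Qed.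

Lemma sum_dot_delta M x (v : 'rV_n) : \sum_k dot M (delta_mx 0 k) x * v 0 k = dot M v x.
Proof.
rewrite /dot -mulmxA mxE; apply: eq_bigr => k _.
by rewrite -mulmxA -rowE mxE mulrC.
Qed.

Lemma dot_rows M (P : 'M[R]_n) i j :
  dot M (row i P) (row j P) = (P *m M *m P^T) i j.
Proof.
by rewrite /dot -row_mul !mxE; apply: eq_bigr => k _; rewrite !mxE.
Qed.

Lemma inner_product_unit M : inner_product M -> M \in unitmx.
Proof.
move=> [_ pos]; rewrite -row_free_unit -kermx_eq0; apply/eqP/row_matrixP => i.
rewrite row0; apply/eqP; apply/negPn/negP => /pos.
have -> : dot M (row i (kermx M)) (row i (kermx M)) = 0.
  by rewrite /dot -row_mul mulmx_ker row0 mul0mx mxE.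
by rewrite ltxx.
Qed.

Lemma inner_product1 : inner_product (1%:M : 'M[R]_n).
Proof.
split=> [|x x0]; first exact: trmx1.
rewrite /dot mulmx1 mxE lt_neqAle eq_sym.
have ge0 : 0 <= \sum_j x 0 j * x^T j 0.
  by apply: sumr_ge0 => j _; rewrite mxE -expr2 sqr_ge0.
rewrite ge0 andbT; apply: contra x0 => /eqP s0; apply/eqP/rowP => i; rewrite [RHS]mxE.
have /(_ i isT) : forall j, true -> x 0 j * x^T j 0 = 0.
  by apply: psumr_eq0P s0 => j _; rewrite mxE -expr2 sqr_ge0.
by rewrite mxE => /eqP; rewrite -expr2 sqrf_eq0 => /eqP.
Qed.
End Dot.

(** * Coefficients of forms and shuffles *)

Section AltSeq.
Variable R : comNzRingType.
Implicit Types (A B F : seq nat -> R) (t u v : seq nat).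

(** Only adjacent entries and lists of length k are constrained, which is what insertion sort
    needs. *)
Definition altseq k A :=
  (forall u x y v, size (u ++ [:: x, y & v]) = k ->
     A (u ++ [:: x, y & v]) = - A (u ++ [:: y, x & v])) /\
  (forall u x v, size (u ++ [:: x, x & v]) = k -> A (u ++ [:: x, x & v]) = 0).

Lemma altseq_cons k A x : altseq k.+1 A -> altseq k (fun t => A (x :: t)).
Proof.
move=> [sw al]; split=> [u y z v su | u y v su].
  by rewrite -[LHS]/(A ((x :: u) ++ _)) sw //= su.
by rewrite -[LHS]/(A ((x :: u) ++ _)) al //= su.
Qed.

(** Each entry of u is passed by one adjacent swap. *)
Lemma altseq_move k A x u v : altseq k A -> size (x :: u ++ v) = k ->
  A (u ++ x :: v) = (-1) ^+ size u * A (x :: u ++ v).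
Proof.
elim: u k A => [|y u IH] k A alt s; first by rewrite mul1r.
case: k s alt => // k [s] alt.
rewrite /= -[LHS]/((fun t => A (y :: t)) (u ++ x :: v)) (IH k) //; last exact: altseq_cons.
have /= -> := alt.1 [::] y x (u ++ v); last by rewrite /= -s.
by rewrite exprS mulN1r mulrN mulNr.
Qed.

Fixpoint insert_sorted x t : option (bool * seq nat) :=
  if t is y :: t' then
    match Nat.compare x y with
    | Eq => None
    | Lt => Some (false, x :: t)
    | Gt => if insert_sorted x t' is Some (b, u) then Some (~~ b, y :: u) else None
    end
  else Some (false, [:: x]).

(* The parity and the result of sorting; None on lists with a repetition. *)
Fixpoint signed_sort t : option (bool * seq nat) :=
  if t is x :: t' then
    if signed_sort t' is Some (b, u) then
      if insert_sorted x u is Some (b', u') then Some (b (+) b', u') else None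
    else None
  else Some (false, [::]).

(** Extends values on increasing lists to an alternating function. The sign is a conditional, not a
    power of -1, so that evaluation on numerals leaves plus or minus a value of A. *)
Definition signed_eval A t : R :=
  if signed_sort t is Some (b, u) then (if b then - A u else A u) else 0.

Lemma insert_sortedP k A x t : altseq k A -> size (x :: t) = k ->
  A (x :: t) = if insert_sorted x t is Some (b, u) then (-1) ^+ b * A u else 0.
Proof.
elim: t x k A => [|y t IH] x k A alt s /=; first by rewrite mul1r.
case: PeanoNat.Nat.compare_spec => [<-|_|_]; first by apply: (alt.2 [::] x t).
  by rewrite mul1r.
case: k s alt => // k [s] alt; have /= -> := alt.1 [::] x y t; last by rewrite /= -s.
rewrite -[A _]/((fun t => A (y :: t)) (x :: t)) (IH x k) //; last exact: altseq_cons.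
by case: (insert_sorted _ _) => [[b u]|]; rewrite ?oppr0 // signrN mulNr.
Qed.

Lemma insert_sorted_size x t b u : insert_sorted x t = Some (b, u) -> size u = (size t).+1.
Proof.
elim: t b u => [|y t IH] b u /=; first by case=> _ <-.
case: Nat.compare => //; first by case=> _ <-.
by case: (insert_sorted _ _) IH => [[b' u']|] // IH [_ <-] /=; rewrite (IH b' u').
Qed.

Lemma signed_sort_size t b u : signed_sort t = Some (b, u) -> size u = size t.
Proof.
elim: t b u => [|y t IH] b u /=; first by case=> _ <-.
case: (signed_sort t) IH => [[b' u']|] // IH.
case E: (insert_sorted _ _) => [[b1 u1]|] // [_ <-].
by rewrite (insert_sorted_size E) (IH b' u').
Qed.

Lemma signed_evalE k A t : altseq k A -> size t = k -> A t = signed_eval A t.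
Proof.
rewrite /signed_eval => alt s.
suff -> : A t = if signed_sort t is Some (b, u) then (-1) ^+ b * A u else 0.
  by case: (signed_sort t) => // -[[] u]; rewrite ?mulN1r ?mul1r.
elim: t k A alt s => [|x t IH] k A alt s /=; first by rewrite mul1r.
case: k s alt => // k [s] alt.
rewrite -[LHS]/((fun t => A (x :: t)) t) (IH k) //; last exact: altseq_cons.
case E: (signed_sort _) => [[b u]|] //.
rewrite (@insert_sortedP k.+1) //=; last by rewrite (signed_sort_size E) s.
case: (insert_sorted _ _) => [[b1 u1]|] //; last by rewrite mulr0.
by rewrite mulrA signr_addb.
Qed.

Lemma insert_sorted_sorted x t b u : sorted ltn t -> insert_sorted x t = Some (b, u) ->
  sorted ltn u /\ perm_eq u (x :: t).
Proof.
elim: t b u => [|y t IH] b u /= yt; first by case=> _ <-.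
case: PeanoNat.Nat.compare_spec => // [xy|yx].
  by case=> _ <-; split=> //=; rewrite yt andbT; apply/ssrnat.ltP.
case E: (insert_sorted x t) => [[b' u']|] // [_ <-].
have [su' pu'] := IH _ _ (path_sorted yt) E; split.
  rewrite /= path_sortedE; last exact: ltn_trans.
  rewrite su' andbT (perm_all _ pu') /=; apply/andP; split; first exact/ssrnat.ltP.
  by move: yt; rewrite path_sortedE //; [case/andP | exact: ltn_trans].
rewrite (perm_trans (y := y :: x :: t)) ?perm_cons //.
by rewrite -[y :: _]/([:: y] ++ [:: x] ++ t) perm_catCA.
Qed.

Lemma signed_sort_sorted t b u : signed_sort t = Some (b, u) ->
  sorted ltn u /\ perm_eq u t.
Proof.
elim: t b u => [|y t IH] b u /=; first by case=> _ <-.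
case E: (signed_sort t) => [[b' u']|] //.
have [su' pu'] := IH _ _ E.
case E': (insert_sorted y u') => [[b1 u1]|] // [_ <-].
have [? p1] := insert_sorted_sorted su' E'; split=> //.
by rewrite (perm_trans p1) // perm_cons.
Qed.

(** An increasing list of indices below n is a mask of 0, .., n - 1, so values on masks determine an
    alternating function. *)
Lemma altseq_ext n k A A' t : altseq k A ->
  (forall m, size m = n -> size (mask m (iota 0 n)) = k ->
     A (mask m (iota 0 n)) = A' (mask m (iota 0 n))) ->
  size t = k -> all (fun i => i < n)%N t -> A t = signed_eval A' t.
Proof.
move=> alt e st tn; rewrite (signed_evalE alt st) /signed_eval.
case E: (signed_sort t) => [[b u]|] //; have [su pu] := signed_sort_sorted E.
suff uE : u = mask [seq i \in u | i <- iota 0 n] (iota 0 n).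
  by rewrite uE e // -?uE ?size_map ?size_iota // (perm_size pu).
rewrite -filter_mask; apply: (irr_sorted_eq ltn_trans ltnn) => //.
  by rewrite sorted_filter ?iota_ltn_sorted //; apply: ltn_trans.
move=> i; rewrite mem_filter mem_iota /= add0n; apply/idP/andP => [iu|[]//].
by split=> //; move: iu; rewrite (perm_mem pu) => /(allP tn).
Qed.

(* The signed sum over the (k, l)-shuffles of t, for size t = k + l. *)
Fixpoint shuffle k l t A B {struct t} : R :=
  if t is x :: t' then
    (if k is k'.+1 then shuffle k' l t' (fun u => A (x :: u)) B else 0)
    + (if l is l'.+1 then (-1) ^+ k * shuffle k l' t' A (fun u => B (x :: u)) else 0)
  else A [::] * B [::].

Lemma eq_shuffle k l t A A' B B' : size t = (k + l)%N ->
  (forall u, size u = k -> {subset u <= t} -> A u = A' u) ->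
  (forall u, size u = l -> {subset u <= t} -> B u = B' u) ->
  shuffle k l t A B = shuffle k l t A' B'.
Proof.
elim: t k l A A' B B' => [|x t IH] k l A A' B B' st eA eB /=.
  move/esym/eqP: st; rewrite addn_eq0 => /andP[/eqP k0 /eqP l0].
  by rewrite eA // eB.
have sub u : {subset u <= t} -> {subset u <= x :: t}.
  by move=> ut y /ut; rewrite inE orbC => ->.
have subc u : {subset u <= t} -> {subset x :: u <= x :: t}.
  by move=> ut y; rewrite !inE => /orP[->|/ut->]; rewrite ?orbT.
congr (_ + _).
  case: k st eA => // k [st] eA; apply: IH => // [u su ut|u su ut].
    by apply: eA; rewrite /= ?su //; apply: subc.
  by apply: eB => //; apply: sub.
case: l st eB => // l st eB; congr (_ * _); apply: IH => // [|u su ut|u su ut].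
- by move: st; rewrite addnS => -[].
- by apply: eA => //; apply: sub.
by apply: eB; rewrite /= ?su //; apply: subc.
Qed.

Lemma shuffleZr k l t A B x : shuffle k l t A (fun u => x * B u) = x * shuffle k l t A B.
Proof.
elim: t k l A B => [|y t IH] k l A B /=; first by rewrite mulrCA.
rewrite mulrDr; congr (_ + _); first by case: k => [|k]; rewrite ?mulr0 ?IH.
by case: l => [|l]; rewrite ?mulr0 // IH mulrCA.
Qed.

(* The signed sum over the permutations of t, organised by the position of the
   first element. *)
Fixpoint perm_sum t F {struct t} : R :=
  if t is x :: t' then
    \sum_(p < size t) (-1) ^+ p * perm_sum t' (fun u => F (take p u ++ x :: drop p u))
  else F [::].

Lemma eq_perm_sum t F F' :
  (forall u, size u = size t -> F u = F' u) -> perm_sum t F = perm_sum t F'.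
Proof.
elim: t F F' => [|x t IH] F F' e /=; first exact: e.
apply: eq_bigr => p _; congr (_ * _); apply: IH => u su; apply: e.
have pu : (p <= size u)%N by rewrite su -ltnS.
by rewrite size_cat /= size_takel // size_drop addnS subnKC // su.
Qed.

Lemma perm_sumZ t F c : perm_sum t (fun u => c * F u) = c * perm_sum t F.
Proof.
elim: t F => [|x t IH] F //=; rewrite mulr_sumr; apply: eq_bigr => p _.
by rewrite IH mulrCA.
Qed.

(** The place p sent to 0 is recovered from the permutation, and then so is s; surjectivity follows
    by counting. *)
Lemma lift_perm_bij n :
  bijective (fun p : 'I_n.+1 * 'S_n => lift_perm p.1 ord0 p.2).
Proof.
apply: inj_card_bij => [[p s] [q t] /= e|]; last first.
  by rewrite card_prod card_ord !card_Sn factS.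
have pq : p = q.
  by have := congr1 (fun s : 'S_n.+1 => (s^-1)%g ord0) e; rewrite !lift_permV !lift_perm_id.
subst q; congr (_, _); apply/permP => i; apply: (@lift_inj _ ord0).
by rewrite -!(lift_perm_lift p) e.
Qed.

(** Permutations are grouped by the place p of the first element, which contributes the sign
    (-1)^p. *)
Lemma sum_perm_seq n (g : 'I_n -> nat) F :
  \sum_(s : 'S_n) (-1) ^+ s * F [seq g (s i) | i <- enum 'I_n] =
  perm_sum [seq g i | i <- enum 'I_n] F.
Proof.
elim: n g F => [|n IH] g F.
  rewrite (big_pred1 1%g) => [|s]; last by apply/esym/eqP/permP => -[].
  rewrite odd_perm1 mul1r; suff -> : enum 'I_0 = [::] by [].
  by apply: size0nil; rewrite size_enum_ord.
rewrite (reindex _ (onW_bij _ (lift_perm_bij n))) /=.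
rewrite -(pair_big predT predT (fun (p : 'I_n.+1) (s : 'S_n) => (-1) ^+ lift_perm p ord0 s
  * F [seq g (lift_perm p ord0 s i) | i <- enum 'I_n.+1])) /=.
rewrite [enum 'I_n.+1 in RHS]enum_ordSl /= size_map size_map size_enum_ord.
apply: eq_bigr => p _.
rewrite -map_comp -(IH _ (fun u => F (take p u ++ g ord0 :: drop p u))) mulr_sumr.
apply: eq_bigr => s _.
rewrite mulrA odd_lift_perm addbF signr_addb signr_odd; congr (_ * F _).
have pn : (p <= n)%N by rewrite -ltnS.
suff H u : size u = n -> (forall j : 'I_n, nth 0%N u j = g (lift ord0 (s j))) ->
    [seq g (lift_perm p ord0 s i) | i <- enum 'I_n.+1] = take p u ++ g ord0 :: drop p u.
  apply: H => [|j]; first by rewrite size_map size_enum_ord.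
  by rewrite (nth_map j) ?size_enum_ord // nth_ord_enum.
move=> sz nthE; apply: (@eq_from_nth _ 0%N) => [|i].
  by rewrite size_map size_enum_ord size_cat /= size_takel ?sz // size_drop sz addnS subnKC.
rewrite size_map size_enum_ord => i_n.
rewrite (nth_map ord0) ?size_enum_ord // -[i]/(nat_of_ord (Ordinal i_n)) nth_ord_enum.
rewrite nth_cat size_takel ?sz //.
case: (unliftP p (Ordinal i_n)) => [j|] -> /=; last first.
  by rewrite lift_perm_id ltnn subnn.
rewrite lift_perm_lift /bump; case: (leqP p j) => pj.
    by rewrite add1n ltnNge ltnW ?ltnS //= subSn //= nth_drop subnKC // -nthE.
by rewrite add0n pj nth_take // nthE.
Qed.

(* Both blocks being alternating, the k! l! permutations with the same
   underlying shuffle contribute equally. *)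
Lemma perm_sum_shuffle k l t A B : size t = (k + l)%N -> altseq k A -> altseq l B ->
  perm_sum t (fun u => A (take k u) * B (drop k u)) = (k`! * l`!)%:R * shuffle k l t A B.
Proof.
elim: t k l A B => [|x t IH] k l A B st Aalt Balt.
  move/esym/eqP: st; rewrite addn_eq0 => /andP[/eqP-> /eqP->].
  by rewrite fact0 mul1r.
rewrite [LHS]/= -[(size t).+1]/(size (x :: t)) st.
rewrite -(big_mkord xpredT (fun p => (-1) ^+ p * perm_sum t (fun u =>
  A (take k (take p u ++ x :: drop p u)) * B (drop k (take p u ++ x :: drop p u))))).
(* For p < k the element x falls in the block of A, otherwise in that of B: the two summands of
   [shuffle]. *)
rewrite (@big_cat_nat _ _ _ k) ?leq_addr //= mulrDr.
congr (_ + _).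
  case: k st Aalt => [|k] st Aalt; first by rewrite big_nil mulr0.
  (* Moving x to the front of its block costs (-1)^p and cancels the sign of the place; the k + 1
     equal terms supply the new factor of the factorial. *)
  case: st => st; rewrite (eq_big_nat _ _ (F2 := fun=>
    perm_sum t (fun u => A (x :: take k u) * B (drop k u)))).
    rewrite sumr_const_nat subn0 (IH k l (fun u => A (x :: u)) B) //; last exact: altseq_cons.
    by rewrite -[LHS]mulr_natl factS -mulnA [in RHS]natrM mulrA.
  move=> p /andP[_ pk]; rewrite -perm_sumZ; apply: eq_perm_sum => u su.
  have pu : (p <= size u)%N by rewrite su st (leq_trans _ (leq_addr _ _)).
  have ku : (k <= size u)%N by rewrite su st leq_addr.
  rewrite take_cat drop_cat size_takel // ltnNge ltnW //= subSn //= take_drop drop_drop.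
  rewrite subnK // (altseq_move Aalt) ?size_takel //; last first.
    by rewrite /= size_cat size_takel // size_drop size_takel // subnKC.
  by rewrite -mulrA signrMK -(take_takel u (pk : (p <= k)%N)) cat_take_drop.
case: l st Balt => [|l] st Balt.
  by rewrite addn0 big_geq ?mulr0.
rewrite -[X in index_iota X _]add0n big_addn addKn.
have {}st : size t = (k + l)%N by move: st; rewrite addnS => -[].
(* At place p + k the sign (-1)^p is absorbed by the block of B, and (-1)^k survives. *)
rewrite (eq_big_nat _ _ (F2 := fun=>
  (-1) ^+ k * perm_sum t (fun u => A (take k u) * B (x :: drop k u)))).
  rewrite sumr_const_nat subn0 (IH k l A (fun u => B (x :: u))) //; last exact: altseq_cons.
  by rewrite -[LHS]mulr_natl factS mulnCA [in RHS]natrM -mulrA [(-1) ^+ k * _]mulrCA.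
move=> p /andP[_ pl]; rewrite -!perm_sumZ; apply: eq_perm_sum => u su.
have ku : (k <= size u)%N by rewrite su st leq_addr.
have pu : (p + k <= size u)%N by rewrite su st addnC leq_add2l.
rewrite addnC takeD -catA take_size_cat ?drop_size_cat ?size_takel // -addnC -drop_drop.
have pk : (p <= size (drop k u))%N by rewrite size_drop leq_subRL // addnC.
rewrite (altseq_move Balt); last first.
  by rewrite /= cat_take_drop size_drop su st addKn.
rewrite cat_take_drop size_takel //; rewrite exprD; move: (A _) (B _) => a b.
have e : (-1) ^+ p * (-1) ^+ p = 1 :> R by rewrite -expr2 sqrr_sign.
transitivity ((-1) ^+ k * (a * b) * ((-1) ^+ p * (-1) ^+ p)); last by rewrite e mulr1.
by ring.
Qed.

End AltSeq.

(** * Components of forms in a frame *)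

Definition frame_rows (R : realType) m n k (P : 'M[R]_(m.+1, n)) (t : seq nat) : 'M[R]_(k, n) :=
  \matrix_(i < k) row (inord (nth 0%N t i)) P.

(** The component of f on the frame vectors listed in t. The frame has m + 1 rows so that natural
    indices can be read through [inord]. *)
Definition coef (R : realType) m n k (P : 'M[R]_(m.+1, n)) (f : kform R n k) (t : seq nat) : R :=
  f (frame_rows k P t).

Section Coef.
Variables (R : realType) (m n : nat) (P : 'M[R]_(m.+1, n)).

(** Polarisation: f vanishes when rows i and j are both replaced by their sum, and expanding leaves
    the two mixed terms. *)
Lemma alternating_swap k (f : kform R n k) (A B : 'M_(k, n)) i j :
  is_alternating f -> i != j -> row i A = row j B -> row j A = row i B ->
  (forall l, l != i -> l != j -> row l A = row l B) -> f A = - f B.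
Proof.
move=> /multilinP[lin alt] ij rij rji rl.
pose M v w : 'M_(k, n) := \matrix_l (if l == i then v else if l == j then w else row l A).
have ji : j != i by rewrite eq_sym.
have Mi v w : row i (M v w) = v by rewrite rowK eqxx.
have Mj v w : row j (M v w) = w by rewrite rowK (negPf ji) eqxx.
have Ml v w l : l != i -> l != j -> row l (M v w) = row l A.
  by move=> /negPf li /negPf lj; rewrite rowK li lj.
have diag v : f (M v v) = 0 by apply: (alt _ i j); rewrite // Mi Mj.
have linl v v' w : f (M (v + v') w) = f (M v w) + f (M v' w).
  rewrite (lin _ (M v w) (M v' w) i 1 1) ?mul1r ?Mi ?scale1r // => l li;
    by have [->|lj] := eqVneq l j; rewrite ?Mj ?Ml.
have linr v w w' : f (M v (w + w')) = f (M v w) + f (M v w').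
  rewrite (lin _ (M v w) (M v w') j 1 1) ?mul1r ?Mj ?scale1r // => l lj;
    by have [->|li] := eqVneq l i; rewrite ?Mi ?Ml.
have -> : A = M (row i A) (row j A).
  apply/row_matrixP => l; have [->|li] := eqVneq l i; first by rewrite Mi.
  by have [->|lj] := eqVneq l j; rewrite ?Mj ?Ml.
have -> : B = M (row j A) (row i A).
  apply/row_matrixP => l; have [->|li] := eqVneq l i; first by rewrite Mi.
  by have [->|lj] := eqVneq l j; rewrite ?Mj ?Ml // rl.
have := diag (row i A + row j A).
rewrite linl !linr !diag add0r addr0 => /eqP.
by rewrite addr_eq0 => /eqP.
Qed.

Lemma coef_altseq k (f : kform R n k) : is_alternating f -> altseq k (coef P f).
Proof.
move=> falt; split=> [u x y v | u x v] s.
  have i1 : (size u < k)%N by rewrite -s size_cat -addn1 leq_add2l.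
  have i2 : ((size u).+1 < k)%N by rewrite -s size_cat /= -addn2 leq_add2l.
  apply: (alternating_swap (i := Ordinal i1) (j := Ordinal i2) falt).
  - by apply/eqP => /(congr1 val) /= /n_Sn.
  - by rewrite !rowK !nth_cat /= ltnn subnn ltnNge leqnSn subSnn.
  - by rewrite !rowK !nth_cat /= ltnn subnn ltnNge leqnSn subSnn.
  move=> l; rewrite -!val_eqE /= => l1 l2; rewrite !rowK !nth_cat.
  case: ltngtP l1 => // lu _.
  have lu2 : ((size u).+2 <= l)%N by rewrite ltn_neqAle eq_sym l2.
  by rewrite -(subnKC lu2) !addSnnS addKn.
have i1 : (size u < k)%N by rewrite -s size_cat -addn1 leq_add2l.
have i2 : ((size u).+1 < k)%N by rewrite -s size_cat /= -addn2 leq_add2l.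
case/multilinP: falt => _ /(_ _ (Ordinal i1) (Ordinal i2)); apply.
  by apply/eqP => /(congr1 val) /= /n_Sn.
by rewrite !rowK !nth_cat /= ltnn subnn ltnNge leqnSn subSnn.
Qed.

Lemma coef_interior k (f : kform R n (1 + k)) a t :
  coef P (interior (row (inord a) P) f) t = coef P (f : kform R n k.+1) (a :: t).
Proof.
congr f; apply/row_matrixP => i.
by case: (split_ordP i) => j ->; apply/rowP => l;
  rewrite !mxE ?(unsplitK (inl j)) ?(unsplitK (inr j)) ?mxE ?ord1.
Qed.

(** The normalisation by k! l! cancels the multiplicity in [perm_sum_shuffle]. *)
Lemma coef_wedge k l (a : kform R n k) (b : kform R n l) t :
  is_alternating a -> is_alternating b -> size t = (k + l)%N ->
  coef P (wedge a b) t = shuffle k l t (coef P a) (coef P b).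
Proof.
move=> aalt balt st; rewrite /coef /wedge.
have nz : (k`! * l`!)%:R != 0 :> R by rewrite pnatr_eq0 muln_eq0 negb_or -!lt0n !fact_gt0.
apply: (canLR (mulKf nz)).
rewrite -(perm_sum_shuffle st (coef_altseq aalt) (coef_altseq balt)).
have -> : perm_sum t = perm_sum [seq nth 0%N t (val i) | i <- enum 'I_(k + l)].
  by rewrite map_comp val_enum_ord -st -/(mkseq _ _) mkseq_nth.
rewrite -(sum_perm_seq (fun i : 'I_(k + l) => nth 0%N t i)).
apply: eq_bigr => s _; rewrite -mulrA; congr (_ * (_ * _)).
  congr a; apply/row_matrixP => i; rewrite rowK.
  apply/rowP => j; rewrite !mxE nth_take // (nth_map (lshift l i))
    ?size_enum_ord ?(leq_trans (ltn_ord i)) ?leq_addr //.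
  by rewrite (nth_ord_enum _ (lshift l i)).
congr b; apply/row_matrixP => i; rewrite rowK.
apply/rowP => j; rewrite !mxE nth_drop (nth_map (rshift k i)) ?size_enum_ord ?ltn_add2l //.
by rewrite (nth_ord_enum _ (rshift k i)).
Qed.

Lemma ce_diff_coef k (L : lieAlgebra R n) (w : 'rV[R]_n -> 'rV[R]_n -> R) (e : 'rV[R]_n)
    (a : kform R n k.+1) t :
  (forall x y, L x y = - w x y *: e) -> is_alternating a -> size t = k.+2 ->
  let del j (s : seq nat) := take j s ++ drop j.+1 s in
  let x i := row (inord (nth 0%N t i)) P in
  coef P (ce_diff L a) t =
  \sum_(j < k.+2) \sum_(i < k.+1 | (i < j)%N) (-1) ^+ (i + j)
     * (- w (x i) (x j) * coef P (interior e (a : kform R n (1 + k))) (del i (del j t))).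
Proof.
move=> LE aalt st del x; apply: eq_bigr => j _; apply: eq_bigr => i ij.
have delE l (j' : 'I_l.+1) s : (j' < size s)%N ->
    row' j' (frame_rows l.+1 P s) = frame_rows l P (del j' s).
  move=> js; apply/row_matrixP => i'; rewrite rowK; apply/rowP => q; rewrite !mxE.
  rewrite /del nth_cat size_takel ?(ltnW js) //=; case: (leqP j' i') => ji.
    by rewrite nth_drop addSn subnKC // /bump ji add1n.
  by rewrite /bump leqNgt ji add0n nth_take.
have jt : (j < size t)%N by rewrite st.
have it : (i < size (del j t))%N.
  by rewrite /del size_cat size_drop size_takel ?(ltnW jt) // -ltnS -addnS -subSn // subSS
    subnKC ?(ltnW jt) // st ltnS.
have -> : row i (row' j (frame_rows k.+2 P t)) = x i.
  by rewrite delE // rowK /del nth_cat size_takel ?(ltnW jt) // ij nth_take.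
rewrite rowK -/(x j) LE !delE //; congr (_ * _).
(* Homogeneity in the first row is linearity with second coefficient 0. *)
move/multilinP: aalt => [lin _]; rewrite (lin _ (col_mx e (frame_rows k P (del i (del j t))))
  (col_mx e (frame_rows k P (del i (del j t)))) ord0 (- w (x i) (x j)) 0).
- by rewrite mul0r addr0.
- by rewrite scale0r addr0; apply/rowP => q; rewrite !mxE; case: split_ordP => l // _; rewrite !mxE.
- move=> l l0; apply/rowP => q; rewrite !mxE; case: split_ordP => // l' lE.
  by move: l0; rewrite -val_eqE /= lE ord1.
- move=> l l0; apply/rowP => q; rewrite !mxE; case: split_ordP => // l' lE.
  by move: l0; rewrite -val_eqE /= lE ord1.
Qed.

End Coef.

(* If [x, y] = - w(x, y) e then d a = w /\ (e _| a). *)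
Section CentralDiff.
Variables (R : realType) (m n : nat) (P : 'M[R]_(m.+1, n)).
Variables (L : lieAlgebra R n) (w : 'rV[R]_n -> 'rV[R]_n -> R) (e : 'rV[R]_n).
Hypothesis LE : forall x y, L x y = - w x y *: e.

Let wP (t : seq nat) :=
  w (row (inord (nth 0%N t 0)) P) (row (inord (nth 0%N t 1)) P).

Ltac expand_ce_diff :=
  rewrite !big_ord_recl !big_ord0 /wP /= /bump /= !(add1n, add0n, addSn);
  repeat match goal with |- context [w ?x ?y] => generalize (w x y) end;
  repeat match goal with |- context [coef P (interior e ?a) ?t] =>
    generalize (coef P (interior e a) t) end;
  by intros; ring.

Lemma coef_ce_diff3 (a : kform R n 3) t : is_alternating a -> size t = 4 ->
  coef P (ce_diff L a) t =
  shuffle 2 2 t wP (coef P (interior e (a : kform R n (1 + 2)))).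
Proof.
move=> aalt st; rewrite (ce_diff_coef P LE aalt st).
case: t st => [|t0 [|t1 [|t2 [|t3 [|]]]]] // _.
under eq_bigr => j _ do rewrite big_mkcond.
expand_ce_diff.
Qed.

Lemma coef_ce_diff4 (a : kform R n 4) t : is_alternating a -> size t = 5 ->
  coef P (ce_diff L a) t =
  shuffle 2 3 t wP (coef P (interior e (a : kform R n (1 + 3)))).
Proof.
move=> aalt st; rewrite (ce_diff_coef P LE aalt st).
case: t st => [|t0 [|t1 [|t2 [|t3 [|t4 [|]]]]]] // _.
under eq_bigr => j _ do rewrite big_mkcond.
expand_ce_diff.
Qed.

End CentralDiff.

Lemma frame_rows_iota (R : realType) m n (M : 'M[R]_(m.+1, n)) :
  frame_rows m.+1 M (iota 0 m.+1) = M.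
Proof.
apply/row_matrixP => i; rewrite rowK nth_iota // add0n.
by congr row; apply: val_inj; rewrite /= inordK.
Qed.

Definition form2 (R : realType) n (w : 'rV[R]_n -> 'rV[R]_n -> R) : kform R n 2 :=
  fun M => w (row (inord 0) M) (row (inord 1) M).

Lemma coef_form2 (R : realType) m n (P : 'M[R]_(m.+1, n)) w t :
  coef P (form2 w) t = w (row (inord (nth 0%N t 0)) P) (row (inord (nth 0%N t 1)) P).
Proof. by rewrite /coef /form2 !rowK !inordK. Qed.

Lemma form2_alt (R : realType) n (W : 'M[R]_n) (a : R) : W^T = - W ->
  is_alternating (form2 (fun x y => a * dot W x y)).
Proof.
move=> WT.
have sk (x y : 'rV_n) : dot W x y = - dot W y x.
  by rewrite -dot_tr WT /dot mulmxN mulNmx mxE.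
have diag (x : 'rV_n) : dot W x x = 0.
  by have /eqP := sk x x; rewrite -addr_eq0 -mulr2n mulrn_eq0 => /eqP.
have ord2 (i : 'I_2) : i = inord 0 \/ i = inord 1.
  by case: i => -[|[|//]] ?; [left | right]; apply: val_inj; rewrite /= inordK.
have i01 : (inord 0 : 'I_2) != inord 1 by rewrite -val_eqE /= !inordK.
apply/multilinP; split=> [A B C i b c rA eB eC | A i j ij rij]; rewrite /form2.
  have [ie|ie] := ord2 i; rewrite ie in rA eB eC.
    rewrite rA dotDl !dotZl (eB (inord 1)) 1?eq_sym // (eC (inord 1)) 1?eq_sym //.
    by rewrite mulrDr; congr (_ + _); rewrite mulrCA.
  rewrite rA dotDr !dotZr (eB (inord 0)) // (eC (inord 0)) //.
  by rewrite mulrDr; congr (_ + _); rewrite mulrCA.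
have [ie|ie] := ord2 i; have [je|je] := ord2 j; move: ij rij; rewrite ie je ?eqxx // => _ rij.
  by rewrite rij diag mulr0.
by rewrite -rij diag mulr0.
Qed.

(** Expansion in the standard basis leaves components on index lists, and alternation reduces these
    to increasing lists. *)
Lemma alternating_eq0 (R : realType) n k (f : kform R n.+1 k) :
  is_alternating f ->
  (forall m, size m = n.+1 -> size (mask m (iota 0 n.+1)) = k ->
     coef 1%:M f (mask m (iota 0 n.+1)) = 0) ->
  forall M, f M = 0.
Proof.
move=> falt f0 M; rewrite -[M]mulmx1 (multilin_expand _ _ falt) big1 // => g _.
have -> : rowsub g 1%:M = frame_rows k (1%:M : 'M[R]_n.+1) [seq val (g i) | i <- enum 'I_k].
  apply/row_matrixP => i; rewrite row_rowsub rowK (nth_map i) ?size_enum_ord //.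
  by rewrite nth_ord_enum; congr row; apply: val_inj; rewrite /= inordK.
rewrite -/(coef _ f _) (altseq_ext (n := n.+1) (A' := fun=> 0) (coef_altseq _ falt)) //.
- by rewrite /signed_eval; case: (signed_sort _) => [[[] u]|]; rewrite ?oppr0 mulr0.
- by rewrite size_map size_enum_ord.
by apply/allP => i /mapP[j _ ->] /=.
Qed.

Section CentralDiffWedge.
Variables (R : realType) (m n : nat).
Variables (L : lieAlgebra R n) (w : 'rV[R]_n -> 'rV[R]_n -> R) (e : 'rV[R]_n).
Hypothesis LE : forall x y, L x y = - w x y *: e.
Hypothesis walt : is_alternating (form2 w).

(** The rows of M serve as the frame. Through [wedge_alt] this also shows that d a is
    alternating. *)
Lemma ce_diff3_wedge (a : kform R n 3) M : is_alternating a ->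
  ce_diff L a M = wedge (form2 w) (interior e (a : kform R n (1 + 2))) M.
Proof.
move=> aalt; rewrite -[in LHS](frame_rows_iota M) -[in RHS](frame_rows_iota M).
transitivity (coef M (wedge (form2 w) (interior e (a : kform R n (1 + 2)))) (iota 0 4)) => //.
rewrite coef_wedge //; last exact: interior_alt.
rewrite -[LHS]/(coef M (ce_diff L a) (iota 0 4)) (coef_ce_diff3 M LE) //.
by apply: eq_shuffle => // u _ _; rewrite coef_form2.
Qed.

Lemma ce_diff4_wedge (a : kform R n 4) M : is_alternating a ->
  ce_diff L a M = wedge (form2 w) (interior e (a : kform R n (1 + 3))) M.
Proof.
move=> aalt; rewrite -[in LHS](frame_rows_iota M) -[in RHS](frame_rows_iota M).
transitivity (coef M (wedge (form2 w) (interior e (a : kform R n (1 + 3)))) (iota 0 5)) => //.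
rewrite coef_wedge //; last exact: interior_alt.
rewrite -[LHS]/(coef M (ce_diff L a) (iota 0 5)) (coef_ce_diff4 M LE) //.
by apply: eq_shuffle => // u _ _; rewrite coef_form2.
Qed.
End CentralDiffWedge.

(** * The Hodge star in an orthonormal frame *)

Lemma orthonormal_invmx (R : realType) n (G P : 'M[R]_n) :
  P *m G *m P^T = 1%:M -> invmx G = P^T *m P.
Proof.
move=> PG; have [_ uPT] := mulmx1_unit PG.
have uP : P \in unitmx by rewrite -unitmx_tr.
have GP : G *m (P^T *m P) = 1%:M.
  by apply: (can_inj (mulKmx uP)); rewrite !mulmxA PG mul1mx mulmx1.
have [uG _] := mulmx1_unit GP.
by rewrite -[RHS](mulKmx uG) GP mulmx1.
Qed.

Section Hodge.
Variables (R : realType) (k l : nat).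

(** By [alt_contraction] the raised indices become a sum over the frame P, and each volume factor
    then splits off the determinant of P. *)
Lemma hodge_frame G o (a : kform R (k + l) k) (P : 'M_(k + l)) N :
  is_alternating a -> P *m G *m P^T = 1%:M ->
  hodge G o a (N *m P) = (-1) ^+ o * Num.sqrt (\det G) * \det P * (k`!%:R^-1 *
    \sum_(g : {ffun 'I_k -> 'I_(k + l)}) a (rowsub g P) * \det (col_mx (rowsub g 1%:M) N)).
Proof.
move=> aalt PG; rewrite /hodge (orthonormal_invmx PG) mulrCA; congr (_ * _).
under eq_bigr => f _ do rewrite -mul_rowsub_mx.
rewrite (alt_contraction P aalt (append_alt (N *m P) (volume_alt G o))) mulr_sumr.
apply: eq_bigr => g _; rewrite [RHS]mulrCA; congr (_ * _).
have -> : col_mx (rowsub g P) (N *m P) = col_mx (rowsub g 1%:M) N *m P.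
  by rewrite mul_col_mx mul_rowsub_mx mul1mx.
by rewrite /volume det_mulmx; ring.
Qed.

Lemma hodge_alt G o (a : kform R (k + l) k) : is_alternating (hodge G o a).
Proof.
rewrite /hodge; apply/multilinP.
have /multilinP[lin alt] : is_alternating (fun N : 'M_(l, k + l) =>
    \sum_(f : {ffun 'I_k -> 'I_(k + l)})
      (k`!%:R^-1 * a (rowsub f 1%:M)) * volume G o (col_mx (rowsub f (invmx G)) N)).
  by apply: alternating_sum => f; apply/prepend_alt/volume_alt.
have E N : k`!%:R^-1 * \sum_(f : {ffun 'I_k -> 'I_(k + l)})
      a (rowsub f 1%:M) * volume G o (col_mx (rowsub f (invmx G)) N) =
    \sum_(f : {ffun 'I_k -> 'I_(k + l)})
      (k`!%:R^-1 * a (rowsub f 1%:M)) * volume G o (col_mx (rowsub f (invmx G)) N).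
  by rewrite mulr_sumr; apply: eq_bigr => f _; rewrite mulrA.
split=> [A B C i b d rA eB eC | A i j ij rij]; rewrite !E.
  exact: lin rA eB eC.
exact: alt ij rij.
Qed.
End Hodge.

(** * Sums over index lists, in a form that evaluates *)

Section ListSum.
Variable R : realType.

Fixpoint list_sum s k (F : seq nat -> R) : R :=
  if k is k'.+1 then foldr (fun x r => list_sum s k' (fun t => F (x :: t)) + r) 0 s
  else F [::].

Lemma list_sumS s k F :
  list_sum s k.+1 F = \sum_(x <- s) list_sum s k (fun t => F (x :: t)).
Proof. by rewrite /= unlock. Qed.

Lemma sum_ffun_list n k (F : seq nat -> R) :
  \sum_(f : {ffun 'I_k -> 'I_n}) F [seq val (f i) | i <- enum 'I_k] =
  list_sum (iota 0 n) k F.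
Proof.
elim: k F => [|k IH] F.
  rewrite (big_pred1 (ffun0 (card_ord 0))) => [|f]; last by apply/esym/eqP/ffunP => -[].
  by congr F; apply: size0nil; rewrite size_map size_enum_ord.
rewrite sum_ffun_recl list_sumS.
transitivity (\sum_(x < n) list_sum (iota 0 n) k (fun t => F (val x :: t))); last first.
  by rewrite -(big_mkord xpredT (fun x => list_sum _ k (fun t => F (x :: t)))) /index_iota subn0.
apply: eq_bigr => x _; rewrite -IH; apply: eq_bigr => f _; congr F.
rewrite enum_ordSl /= ffunE unlift_none /=; congr (_ :: _).
by rewrite -map_comp; apply: eq_map => i; rewrite /= ffunE liftK.
Qed.

Lemma list_sum_filter s k (p : pred nat) F :
  (forall t, size t = k -> ~~ all p t -> F t = 0) ->
  list_sum s k F = list_sum (filter p s) k F.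
Proof.
have sum0 s' l F' : (forall t, size t = l -> F' t = 0) -> list_sum s' l F' = 0.
  elim: l F' => [|l IH] F' F0; first exact: F0.
  by rewrite list_sumS big1 // => x _; apply: IH => t st; apply: F0; rewrite /= st.
elim: k F => [|k IH] F F0 //; rewrite !list_sumS big_filter [LHS](bigID p) /=.
rewrite [X in _ + X]big1 ?addr0 => [|x px].
  apply: eq_bigr => x px; apply: IH => t st pt; apply: F0; rewrite /= ?st //.
  by rewrite px.
by apply: sum0 => t st; apply: F0; rewrite /= ?st // (negPf px).
Qed.

Lemma eq_list_sum s k F F' :
  (forall t, size t = k -> {subset t <= s} -> F t = F' t) ->
  list_sum s k F = list_sum s k F'.
Proof.
elim: k F F' => [|k IH] F F' e; first exact: e.
rewrite !list_sumS; apply: eq_big_seq => x xs; apply: IH => t st ts; apply: e.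
  by rewrite /= st.
by move=> y; rewrite inE => /orP[/eqP->|/ts].
Qed.
End ListSum.

(** Only lists u avoiding t contribute, a repeated index giving two equal rows in the determinant.
    All orderings of u are summed, hence the division by the factorial. *)
Lemma coef_hodge (R : realType) k l (P G : 'M[R]_((k + l).+1)) o
    (a : kform R (k + l).+1 k.+1) t :
  is_alternating a -> P *m G *m P^T = 1%:M -> size t = l ->
  let vol := coef 1%:M (fun M : 'M[R]_((k + l).+1) => \det M) in
  coef P (@hodge R k.+1 l G o a) t =
  (-1) ^+ o * Num.sqrt (\det G) * \det P * (k.+1`!%:R^-1 *
    list_sum [seq i <- iota 0 (k + l).+1 | i \notin t] k.+1 (fun u => coef P a u * vol (u ++ t))).
Proof.
move=> aalt PG st vol; rewrite /coef.
have -> : frame_rows l P t = frame_rows l 1%:M t *m P.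
  by apply/row_matrixP => i; rewrite row_mul !rowK -row_mul mul1mx.
rewrite (@hodge_frame R k.+1 l) //; congr (_ * (_ * _)).
rewrite -list_sum_filter => [|u su].
  rewrite -(sum_ffun_list (k + l).+1); apply: eq_bigr => f _; congr (_ * _).
    congr a; apply/row_matrixP => i; rewrite row_rowsub rowK.
    rewrite (nth_map i) ?size_enum_ord // nth_ord_enum; congr row.
    by apply: val_inj; rewrite /= inordK.
  rewrite /vol /coef; congr determinant; apply/row_matrixP => i; rewrite rowK.
  case: (split_ordP (i : 'I_(k.+1 + l))) => j -> /=.
    apply/rowP => q; rewrite mxE -[LHS]/(col_mx _ _ _ _) col_mxEu !mxE.
    rewrite nth_cat size_map size_enum_ord ltn_ord.
    rewrite (nth_map j) ?size_enum_ord // nth_ord_enum.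
    by congr (_ == _)%:R; apply: val_inj; rewrite /= inordK.
  apply/rowP => q; rewrite mxE -[LHS]/(col_mx _ _ _ _) col_mxEd !mxE.
  by rewrite nth_cat size_map size_enum_ord ltnNge leq_addr addKn.
move=> /allPn[x xu /negPn xt]; rewrite [X in _ * X](_ : _ = 0) ?mulr0 //.
have xu' := xu; have xt' := xt; rewrite -!index_mem in xu' xt'.
have i1 : (index x u < (k + l).+1)%N by rewrite (leq_trans xu') // su ltnS leq_addr.
have i2 : (size u + index x t < (k + l).+1)%N by rewrite su addSn ltnS ltn_add2l -st.
apply: (@determinant_alternate _ _ _ (Ordinal i1) (Ordinal i2)).
  by rewrite -val_eqE /= neq_ltn ltn_addr.
move=> q; rewrite !mxE /= !nth_cat xu' ltnNge leq_addr addKn /=.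
by rewrite !nth_index.
Qed.

Ltac case6 i := case: i => [|[|[|[|[|[|//]]]]]] _.

(** Membership is tested by standard-library functions on numerals so that [cbv] can evaluate it;
    [complE] gives the usual form. *)
Definition compl n (t : seq nat) := filter (fun i => ~~ List.existsb (Nat.eqb i) t) (iota 0 n).

Lemma complE n t : compl n t = [seq i <- iota 0 n | i \notin t].
Proof.
apply: eq_filter => i; congr (~~ _); elim: t => //= j t ->.
by rewrite inE; congr (_ || _); apply/idP/eqP => /PeanoNat.Nat.eqb_eq.
Qed.

(** * Identities for 3-forms in dimension 6 and 7 *)

(* c and w hold the coefficients of phi and omega in a frame e_0, .., e_6 with
   e_6 central; sigma is e_6 _| phi and rho is phi on e_0, .., e_5. *)
Section Identities.
Variables (R : realType) (c w D : seq nat -> R).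
Implicit Types (i j k : nat).

(* sgn(t, t') A(t'), for t' the complement of t in 0, .., n - 1 *)
Definition dual n (A : seq nat -> R) t : R :=
  signed_eval (fun=> 1) (t ++ compl n t) * A (compl n t).

(** The value of (e_i _| phi) /\ (e_j _| phi) /\ phi on e_0, .., e_6. *)
Definition g2_coef i j := shuffle 4 3 (iota 0 7)
  (fun t => shuffle 2 2 t (fun u => signed_eval c (i :: u)) (fun u => signed_eval c (j :: u)))
  (signed_eval c).

Definition sigma_coef i j := signed_eval c [:: 6%N; i; j].
Definition omega_coef i j := signed_eval w [:: i; j].
(* Hitchin's endomorphism of the 3-form rho = c restricted to 0, .., 5 *)
Definition hitchin_coef i j :=
  dual 6 (fun h => shuffle 2 3 h (fun u => signed_eval c (j :: u)) (signed_eval c)) [:: i].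
(* * (sigma /\ rho) *)
Definition sigma_rho i :=
  dual 6 (fun h => shuffle 2 3 h (fun u => signed_eval c (6%N :: u)) (signed_eval c)) [:: i].
(* * (sigma /\ sigma) *)
Definition sigma_sq i j := dual 6 (fun h => shuffle 2 2 h
  (fun u => signed_eval c (6%N :: u)) (fun u => signed_eval c (6%N :: u))) [:: i; j].

Definition sum6 (F : nat -> R) := F 0%N + (F 1%N + (F 2%N + (F 3%N + (F 4%N + F 5%N)))).

(** The contraction of omega with rho, each pair of indices being counted twice. *)
Definition omega_rho k :=
  sum6 (fun i => sum6 (fun j => omega_coef i j * signed_eval c [:: i; j; k])).

(* Unfolds the combinatorics only, leaving a polynomial identity in the
   coefficients on increasing lists. *)
Ltac evaluate :=
  cbv beta iota zeta delta [sum6 compl dual g2_coef sigma_coef omega_coef hitchin_coef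
    sigma_rho sigma_sq omega_rho list_sum foldr
    signed_eval signed_sort insert_sorted shuffle Nat.compare Nat.eqb filter List.existsb
    iota cat addb negb orb].

(** Pfaffian form of the adjugate identity: the dual of sigma^2 consists of sub-Pfaffians of sigma
    up to a factor, and [g2_coef] at (6, 6) is sigma^3. *)
Lemma sigma_sigma_sq i j : (i < 6)%N -> (j < 6)%N ->
  3 * sum6 (fun k => sigma_coef i k * sigma_sq k j) = if Nat.eqb i j then - g2_coef 6%N 6%N else 0.
Proof. case6 i; case6 j; evaluate; ring. Qed.

(** With s_i = e_i _| sigma: contracting sigma^2 /\ rho, which vanishes for degree reasons on U, by
    e_i turns both terms of the product into multiples of s_i /\ sigma /\ rho. *)
Lemma g2_coef6 i : (i < 6)%N ->
  g2_coef 6%N i = - 3 * sum6 (fun k => sigma_coef i k * sigma_rho k).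
Proof. case6 i; evaluate; ring. Qed.

(** With r_i = e_i _| rho, the 7-forms sigma /\ r_i /\ rho and sigma /\ r_j /\ rho vanish on U;
    contracting them by e_j and e_i eliminates all but two of the products. *)
Lemma g2_coef_hitchin i j : (i < 6)%N -> (j < 6)%N ->
  g2_coef i j = 3 * sum6 (fun k => sigma_rho k * signed_eval c [:: i; j; k])
    - 3 * sum6 (fun k => sigma_coef i k * hitchin_coef k j).
Proof. case6 i; case6 j; evaluate; ring. Qed.

(** The scalar is, up to normalisation, Hitchin's quartic invariant of rho, read off the (0, 0)
    entry. *)
Lemma hitchin_sq i j : (i < 6)%N -> (j < 6)%N ->
  sum6 (fun k => hitchin_coef i k * hitchin_coef k j) =
  if Nat.eqb i j then sum6 (fun k => hitchin_coef 0%N k * hitchin_coef k 0%N) else 0.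
Proof. case6 i; case6 j; evaluate; ring. Qed.

(** This is how coclosedness enters: if omega contracts to 0 with rho, then the product of K and
    omega is symmetric. *)
Lemma hitchin_omega i j : (i < 6)%N -> (j < 6)%N ->
  sum6 (fun k => hitchin_coef i k * omega_coef k j)
    - sum6 (fun k => hitchin_coef j k * omega_coef k i)
  = sum6 (fun k => omega_rho k * dual 6 (signed_eval c) [:: i; j; k]).
Proof. case6 i; case6 j; evaluate; ring. Qed.

(** Here omega /\ sigma /\ rho is a 7-form on U, hence 0, and only omega /\ sigma^2 /\ eta survives;
    the right-hand side is its trace form. *)
Lemma omega_sigma_sq : (forall i, w [:: i; 6%N] = 0) ->
  2 * shuffle 4 3 (iota 0 7) (fun t => shuffle 2 2 t (signed_eval w)
     (fun u => signed_eval c (6%N :: u))) (signed_eval c) =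
  - sum6 (fun i => sum6 (fun j => omega_coef i j * sigma_sq j i)).
Proof. by move=> w6; evaluate; rewrite !w6; ring. Qed.

(** Contracting the star of phi with e_6 leaves the dual of rho up to sign, and wedging with omega
    is dual to contracting. The 3 is 3! orderings of v over the double count in [omega_rho]. *)
Lemma omega_hodge k : (k < 6)%N ->
  (-1) ^+ k * shuffle 2 3 (compl 6 [:: k]) (signed_eval w) (fun u =>
    list_sum (compl 7 (6%N :: u)) 3 (fun v => signed_eval c v * signed_eval D (v ++ 6%N :: u))) =
  - 3 * D (iota 0 7) * omega_rho k.
Proof. case6 k; evaluate; ring. Qed.

End Identities.

(** * Nilsolitons with one-dimensional derived algebra *)

Section CentralRicci.
Variables (R : realType) (n : nat) (L : lieAlgebra R n) (W : 'M[R]_n) (e : 'rV[R]_n).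
Variable G : 'M[R]_n.
Hypotheses (LE : forall x y, L x y = - dot W x y *: e) (WT : W^T = - W) (eW : e *m W = 0).
Hypothesis Gip : inner_product G.

Let H := invmx G.
(** J represents omega, g(x J, y) = W(x, y), and Q is the symmetric form g(x J^2, y). *)
Let J := W *m H.
Let Q := W *m H *m W.

Let uG : G \in unitmx := inner_product_unit Gip.

Lemma gram_symE x y : dot G x y = dot G y x.
Proof. by rewrite -{1}Gip.1 dot_tr. Qed.

Lemma central_skewE x y : dot W x y = - dot W y x.
Proof. by rewrite -dot_tr WT /dot mulmxN mulNmx mxE. Qed.

Lemma invmx_gram_sym : H^T = H.
Proof. by rewrite /H trmx_inv Gip.1. Qed.

Lemma central_JT : J^T = - (H *m W).
Proof. by rewrite trmx_mul invmx_gram_sym WT mulmxN. Qed.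

Lemma central_QT : Q^T = Q.
Proof. by rewrite /Q trmx_mul central_JT WT mulmxN mulNmx opprK mulmxA. Qed.

Lemma dot_W_J x y : dot W x (y *m J) = - dot Q x y.
Proof.
by rewrite /dot trmx_mul central_JT mulNmx mulmxN mxE !mulmxA.
Qed.

Lemma dot_G_e_J x : dot G e (x *m J) = 0.
Proof.
rewrite /dot trmx_mul central_JT mulNmx mulmxN !mulmxA mulmxK //.
by rewrite eW mul0mx oppr0 mxE.
Qed.

Lemma dot_W_e x : dot W x e = 0.
Proof. by rewrite central_skewE /dot eW mul0mx mxE oppr0. Qed.

Lemma eJ : e *m J = 0.
Proof. by rewrite mulmxA eW mul0mx. Qed.

Lemma levi_civita_central x y : levi_civita L G x y =
  2^-1 *: (- dot W x y *: e + dot G e x *: (y *m J) + dot G e y *: (x *m J)).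
Proof.
rewrite /levi_civita -/H.
(* Factoring out the inverse Gram matrix leaves Koszul's formula component by component. *)
have -> : 2^-1 *: (- dot W x y *: e + dot G e x *: (y *m J) + dot G e y *: (x *m J)) =
    (2^-1 *: (- dot W x y *: (e *m G) + dot G e x *: (y *m W) + dot G e y *: (x *m W))) *m H.
  by rewrite -scalemxAl !mulmxDl -!scalemxAl mulmxK // !mulmxA.
have DE (u v : 'rV[R]_n) k : (u + v) 0 k = u 0 k + v 0 k by rewrite mxE.
have ZE a (u : 'rV[R]_n) k : (a *: u) 0 k = a * u 0 k by rewrite mxE.
congr (_ *m H); apply/rowP => k; rewrite mxE !(DE, ZE) !LE !dotZl.
rewrite (central_skewE (delta_mx 0 k)) !dot_deltar.
by ring.
Qed.

Lemma curvature_central x y z : curvature L G x y z =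
  4^-1 *: ((dot G e y * dot Q x z - dot G e x * dot Q y z) *: e
     + dot G e z *: (dot G e x *: (y *m J *m J) - dot G e y *: (x *m J *m J))
     - (dot G e e * dot W y z) *: (x *m J) + (dot G e e * dot W x z) *: (y *m J))
  + (2^-1 * dot G e e * dot W x y) *: (z *m J).
Proof.
rewrite /curvature LE !levi_civita_central.
rewrite !(dotZr, dotZl, dotDr, dotDl) !dot_W_J !dot_G_e_J !dot_W_e.
rewrite -!scalemxAl !mulmxDl -!scalemxAl eJ.
have -> : dot W e z = 0 by rewrite central_skewE dot_W_e oppr0.
have -> : dot Q y x = dot Q x y by rewrite -{1}central_QT dot_tr.
have DE (u v : 'rV[R]_n) k : (u + v) 0 k = u 0 k + v 0 k by rewrite mxE.
have ZE a (u : 'rV[R]_n) k : (a *: u) 0 k = a * u 0 k by rewrite mxE.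
have NE (u : 'rV[R]_n) k : (- u) 0 k = - u 0 k by rewrite mxE.
have E0 k : (0 : 'rV[R]_n) 0 k = 0 by rewrite mxE.
by apply/rowP => k; rewrite !(DE, ZE, NE, E0); field.
Qed.

Lemma ricci_central y z : ricci L G y z =
  2^-1 * dot G e e * dot Q y z - 4^-1 * \tr (J *m J) * dot G e y * dot G e z.
Proof.
have DE (u v : 'rV[R]_n) k : (u + v) 0 k = u 0 k + v 0 k by rewrite mxE.
have ZE a (u : 'rV[R]_n) k : (a *: u) 0 k = a * u 0 k by rewrite mxE.
have NE (u : 'rV[R]_n) k : (- u) 0 k = - u 0 k by rewrite mxE.
have trE (M : 'M[R]_n) : \sum_k (delta_mx 0 k *m M : 'rV_n) 0 k = \tr M.
  by apply: eq_bigr => k _; rewrite -rowE mxE.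
have trJ : \tr J = 0.
  have : \tr J = - \tr J.
    by rewrite -{1}mxtrace_tr central_JT -scaleN1r mxtraceZ mulN1r mxtrace_mulC.
  by move/eqP; rewrite -addr_eq0 -mulr2n mulrn_eq0 => /eqP.
pose eps k := dot G (delta_mx 0 k) e.
have epsE k : dot G e (delta_mx 0 k) = eps k by rewrite gram_symE.
(* The terms are arranged so that each sum over k is a contraction ([sum_dot_delta]) or a trace. *)
transitivity (\sum_k
  (4^-1 * dot G e y * (dot Q (delta_mx 0 k) z * e 0 k)
   - 4^-1 * dot Q y z * (eps k * e 0 k)
   + 4^-1 * dot G e z * (eps k * (y *m J *m J) 0 k)
   - 4^-1 * dot G e z * dot G e y * (delta_mx 0 k *m (J *m J) : 'rV_n) 0 k
   - 4^-1 * dot G e e * dot W y z * (delta_mx 0 k *m J : 'rV_n) 0 k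
   + 4^-1 * dot G e e * (dot W (delta_mx 0 k) z * (y *m J) 0 k)
   + 2^-1 * dot G e e * (dot W (delta_mx 0 k) y * (z *m J) 0 k))).
  apply: eq_bigr => k _; rewrite curvature_central !(DE, ZE, NE) !epsE !mulmxA.
  by field.
rewrite !(big_split, sumrN) /= -!mulr_sumr !sum_dot_delta !trE trJ.
rewrite [dot G (_ *m J) e]gram_symE dot_G_e_J.
have -> : dot Q e z = 0 by rewrite /dot !mulmxA eW !mul0mx mxE.
have WJ u v : dot W (u *m J) v = dot Q u v by rewrite /dot /J /Q !mulmxA.
rewrite !WJ; have -> : dot Q z y = dot Q y z by rewrite -{1}central_QT dot_tr.
by field.
Qed.

Lemma ricci_endo_central : ricci_endo L G =
  (2^-1 * dot G e e) *: (J *m J) - (4^-1 * \tr (J *m J)) *: (G *m e^T *m e).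
Proof.
rewrite /ricci_endo -/H.
have -> : \matrix_(i, j) ricci L G (delta_mx 0 i) (delta_mx 0 j) =
    (2^-1 * dot G e e) *: Q - (4^-1 * \tr (J *m J)) *: (G *m e^T *m (e *m G)).
  apply/matrixP => i j; rewrite mxE ricci_central dot_delta !dot_deltar.
  have DE (A B : 'M[R]_n) : (A - B) i j = A i j - B i j by rewrite !mxE.
  have ZE a (A : 'M[R]_n) : (a *: A) i j = a * A i j by rewrite mxE.
  rewrite DE !ZE -[in RHS]mulrA; congr (_ - _); rewrite -mulrA; congr (_ * _).
  rewrite [in RHS]mxE big_ord1; congr (_ * _).
  rewrite -{1}Gip.1 -[e *m G^T]trmxK trmx_mul trmxK mxE.
  by [].
rewrite mulmxBl -!scalemxAl !mulmxA; congr (_ - _ *: _).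
by rewrite mulmxK.
Qed.

(** Put N = g(e, e), t = tr J^2, D = Rc - l Id. Then e D = mu e with mu = - t N / 4 - l, and D W = W
    D^T = (N / 2) W H W H W - l W. As all brackets are multiples of e, D is a derivation iff mu W =
    D W + W D^T, that is, N W H W H W = (mu + 2 l) W. *)
Lemma nilsoliton_centralP : e != 0 ->
  nilsoliton L G <-> exists k, W *m H *m W *m H *m W = k *: W.
Proof.
move=> e0; pose N := dot G e e; pose t := \tr (J *m J).
have N0 : N != 0 by rewrite gt_eqF ?Gip.2.
pose X := W *m H *m W *m H *m W.
have XT : X^T = - X.
  by rewrite /X !trmx_mul WT invmx_gram_sym !(mulmxN, mulNmx) !opprK !mulmxA.
have DW l : (ricci_endo L G - l%:M) *m W = (2^-1 * N) *: X - l *: W.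
  rewrite ricci_endo_central !mulmxBl -!scalemxAl -(mulmxA _ e) eW mulmx0 scaler0 subr0.
  by rewrite mul_scalar_mx /J !mulmxA.
have WD l : W *m (ricci_endo L G - l%:M)^T = (2^-1 * N) *: X - l *: W.
  apply: trmx_inj; rewrite trmx_mul trmxK WT mulmxN DW.
  have ZT a (A : 'M[R]_n) : (a *: A)^T = a *: A^T by rewrite linearZ.
  by rewrite [RHS]linearB /= !ZT XT WT !scalerN opprB opprK addrC.
have eD l : e *m (ricci_endo L G - l%:M) = (- (4^-1 * t * N) - l) *: e.
  rewrite ricci_endo_central mulmxBr mulmxBr -!scalemxAr (mulmxA e J J) eJ mul0mx scaler0 sub0r.
  rewrite (mulmxA e (G *m e^T) e) (mulmxA e G) [e *m G *m e^T]mx11_scalar.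
  rewrite mul_scalar_mx scalerA -scaleNr mul_mx_scalar.
  by rewrite -scalerBl.
split=> [[_ [l [D [Dder DE]]]] | [k Xk]].
  have {}DE : D = ricci_endo L G - l%:M by rewrite DE addrC addKr.
  exists ((- (4^-1 * t * N) - l + 2 * l) / N).
  have key : (- (4^-1 * t * N) - l) *: W =
      (2^-1 * N) *: X - l *: W + ((2^-1 * N) *: X - l *: W).
    rewrite -{1}DW -WD -DE; apply/matrixP => i j.
    have := Dder (delta_mx 0 i) (delta_mx 0 j).
    rewrite !LE -scalemxAl DE eD scalerA -scalerDl => /eqP.
    rewrite -subr_eq0 -scalerBl scaler_eq0 (negPf e0) orbF subr_eq0 => /eqP.
    have -> : dot W (delta_mx 0 i *m (ricci_endo L G - l%:M)) (delta_mx 0 j) =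
        ((ricci_endo L G - l%:M) *m W) i j.
      by rewrite dot_deltar -mulmxA -rowE mxE.
    have -> : dot W (delta_mx 0 i) (delta_mx 0 j *m (ricci_endo L G - l%:M)) =
        (W *m (ricci_endo L G - l%:M)^T) i j.
      by rewrite -dot_delta /dot trmx_mul !mulmxA.
    rewrite dot_delta mulNr => /(congr1 (fun u => - u)).
    rewrite opprK opprD !opprK => E.
    by rewrite [LHS]mxE mulrC E [RHS]mxE.
  have eX : N *: X = (- (4^-1 * t * N) - l + 2 * l) *: W.
    rewrite [RHS]scalerDl key; apply/matrixP => i j.
    have DE' (A B : 'M[R]_n) : (A + B) i j = A i j + B i j by rewrite !mxE.
    have NE (A : 'M[R]_n) : (- A) i j = - A i j by rewrite !mxE.
    have ZE a (A : 'M[R]_n) : (a *: A) i j = a * A i j by rewrite mxE.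
    by rewrite !(DE', NE, ZE); field.
  by rewrite mulrC -scalerA -eX scalerA mulVf // scale1r.
split=> //.
(* The scalar l solves N k = mu + 2 l = l - t N / 4. *)
exists (N * (k + 4^-1 * t)), (ricci_endo L G - (N * (k + 4^-1 * t))%:M).
split; last by rewrite addrC subrK.
move=> x y; rewrite !LE -scalemxAl eD scalerA -scalerDl; congr (_ *: _).
have -> : dot W (x *m (ricci_endo L G - (N * (k + 4^-1 * t))%:M)) y =
    (2^-1 * N * k - N * (k + 4^-1 * t)) * dot W x y.
  by rewrite {1}/dot -(mulmxA x) DW (Xk : X = _) scalerA -scalerBl -scalemxAr -scalemxAl mxE.
have -> : dot W x (y *m (ricci_endo L G - (N * (k + 4^-1 * t))%:M)) =
    (2^-1 * N * k - N * (k + 4^-1 * t)) * dot W x y.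
  rewrite {1}/dot trmx_mul !mulmxA -(mulmxA x) WD (Xk : X = _) scalerA -scalerBl.
  by rewrite -scalemxAr -scalemxAl mxE.
by field.
Qed.
End CentralRicci.

(** * The obstruction *)

Section Matrices.
Variable R : rcfType.

Lemma scalar_mx_inj n : injective (@scalar_mx R n.+1).
Proof. by move=> a b /matrixP/(_ 0 0); rewrite !mxE eqxx. Qed.

(** A diagonal entry of S S^T = - S^2 is a sum of squares. *)
Lemma skew_sq_lt0 n (S : 'M[R]_n.+1) (m : R) :
  S^T = - S -> S *m S = m%:M -> m != 0 -> m < 0.
Proof.
move=> ST SS m0; rewrite lt_neqAle m0 -oppr_ge0 /=.
have : (S *m S^T) 0 0 = - m by rewrite ST mulmxN SS !mxE eqxx.
by move<-; rewrite mxE; apply: sumr_ge0 => j _; rewrite mxE -expr2 sqr_ge0.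
Qed.

(* E / sqrt(E^2) has eigenvalues +-1, whose eigenspaces have even dimension as
   they are stable under S; so in dimension 2 (mod 4) the trace of E is not 0. *)
Lemma commuting_complex_structure_trace (S E : 'M[R]_6) (m r : R) :
  m < 0 -> 0 < r -> S *m S = m%:M -> E *m E = (r ^+ 2)%:M -> S *m E = E *m S ->
  \tr E != 0.
Proof.
move=> m0 r0 SS EE SE; apply/eqP => trE.
(* The projection onto the eigenspace of E for r; if tr E = 0 its trace, hence its rank, is 3. *)
pose Q := 2^-1 *: (1%:M + r^-1 *: E).
have r_nz : r != 0 by rewrite gt_eqF.
have n2 : (2 : R) != 0 by rewrite pnatr_eq0.
have QQ : Q *m Q = Q.
  rewrite /Q -scalemxAl -scalemxAr mulmxDl !mulmxDr !mul1mx mulmx1 -scalemxAl -scalemxAr EE.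
  apply/matrixP => i j; rewrite !mxE.
  by case: (i == j); rewrite ?mulr1n ?mulr0n; field; rewrite ?n2 ?r_nz.
have SQ : S *m Q = Q *m S.
  by rewrite /Q -scalemxAl -scalemxAr mulmxDl mulmxDr mul1mx mulmx1 -scalemxAl -scalemxAr SE.
have trQ : \tr Q = 3.
  by rewrite /Q mxtraceZ mxtraceD mxtrace1 mxtraceZ trE; field.
have CB_ex : exists (C : 'M[R]_(6, \rank Q)) (B : 'M[R]_(\rank Q, 6)),
    C *m B = Q /\ B *m C = 1%:M.
  exists (col_base Q), (row_base Q); split; first exact: mulmx_base.
  apply: (row_free_inj (row_base_free Q)); apply: (row_full_inj (col_base_full Q)).
  by rewrite mul1mx -(mulmxA (row_base Q)) mulmx_base mulmxA mulmx_base QQ.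
have rk : \rank Q = 3%N.
  have [C [B [CB BC]]] := CB_ex.
  by move: trQ; rewrite -{1}CB mxtrace_mulC BC mxtrace1 => /eqP; rewrite eqr_nat => /eqP.
rewrite rk in CB_ex; have [C [B [CB BC]]] := CB_ex.
(* B S C is the restriction of S to this 3-dimensional eigenspace. It squares to m, so its
   determinant squares to m^3 < 0. *)
have : \det (B *m S *m C) ^+ 2 = m ^+ 3.
  rewrite expr2 -det_mulmx -det_scalar; congr determinant.
  rewrite !mulmxA -(mulmxA (B *m S)) CB -(mulmxA (B *m S)) -SQ !mulmxA -(mulmxA B S S) SS.
  by rewrite -(mulmxA _ Q C) -CB -(mulmxA C B C) BC mulmx1 mul_mx_scalar -scalemxAl BC scalemx1.
move=> e; have := sqr_ge0 (\det (B *m S *m C)).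
rewrite e exprS leNgt => /negP; apply.
by rewrite nmulr_rlt0 // exprn_even_gt0 //= lt_eqF.
Qed.

(** S, K, W, A stand for sigma, Hitchin's endomorphism, omega and the dual of sigma^2. Both K and A
    turn out to be multiples of S, so symmetry of K W means that S and W commute, and the trace of W
    A is a multiple of that of W S. *)
Lemma su3_no_square (S K W A : 'M[R]_6) (p b l k : R) :
  S^T = - S -> W^T = - W -> p != 0 -> b != 0 ->
  S *m A = p%:M -> S *m K = b%:M -> K *m K = l%:M ->
  (K *m W)^T = K *m W -> W *m W = k%:M -> k != 0 -> \tr (W *m A) != 0.
Proof.
move=> ST WT p0 b0 SA SK KK KW WW k0.
have KS : K *m S = b%:M.
  have : S *m (b^-1 *: K) = 1%:M by rewrite -scalemxAr SK scale_scalar_mx mulVf.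
  move/mulmx1C; rewrite -scalemxAl => e.
  by rewrite -[LHS](scalerKV b0) e scalemx1.
have lS : l *: S = b *: K.
  by rewrite -mul_scalar_mx -KK -mulmxA KS mul_mx_scalar.
have l0 : l != 0.
  apply/eqP => l0; have /eqP := congr1 (fun M => S *m M) lS.
  rewrite l0 scale0r mulmx0 -scalemxAr SK scale_scalar_mx eq_sym => /eqP.
  rewrite -[RHS](raddf0 (@scalar_mx R 6)) => /scalar_mx_inj /eqP.
  by rewrite mulf_eq0 (negPf b0).
have KE : K = (l / b) *: S by rewrite mulrC -scalerA lS scalerA mulVf // scale1r.
pose m := b ^+ 2 / l.
have SS : S *m S = m%:M.
  have -> : S *m S = (b / l) *: (S *m K).
    have e : b / l * (l / b) = 1 by field; rewrite b0 l0.
    by rewrite KE -scalemxAr scalerA e scale1r.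
  by rewrite SK scale_scalar_mx; congr _%:M; rewrite /m; field.
have m0 : m != 0 by rewrite mulf_neq0 ?expf_neq0 ?invr_eq0.
have AE : A = (p / m) *: S.
  rewrite mulrC -scalerA -[p *: S]mul_mx_scalar -SA mulmxA SS mul_scalar_mx scalerA.
  by rewrite mulVf // scale1r.
have lb0 : l / b != 0 by rewrite mulf_neq0 ?invr_eq0.
have SW : S *m W = W *m S.
  move: KW; rewrite KE -!scalemxAl linearZ /= trmx_mul ST WT mulNmx mulmxN opprK.
  by move/(scalerI lb0).
have WS2 : (W *m S) *m (W *m S) = (k * m)%:M.
  rewrite -{2}SW mulmxA -(mulmxA W) SS mul_mx_scalar -scalemxAl WW scale_scalar_mx.
  by rewrite mulrC.
(* Both k and m are squares of skew matrices, hence negative; the square root of k m is the r of the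
   trace lemma. *)
have km : 0 < k * m by rewrite nmulr_rgt0 ?(skew_sq_lt0 ST SS) ?(skew_sq_lt0 WT WW).
rewrite AE -scalemxAr mxtraceZ mulf_neq0 // ?mulf_neq0 ?invr_eq0 //.
apply: (@commuting_complex_structure_trace S _ m (Num.sqrt (k * m))) => //.
- exact: skew_sq_lt0 ST SS m0.
- by rewrite sqrtr_gt0.
- by rewrite WS2 sqr_sqrtr // ltW.
- by rewrite mulmxA SW.
Qed.
End Matrices.

(** * Orthonormal frames adapted to the last basis vector *)

Section Frames.
Variable R : realType.

(* P comes from the Schur complement of the last diagonal entry of G. *)
Lemma orthonormal_frame_step n (G : 'M[R]_(n + 1)) :
  (forall G' : 'M[R]_n, inner_product G' -> exists P : 'M_n, P *m G' *m P^T = 1%:M) ->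
  inner_product G ->
  exists (P : 'M[R]_n) (u : 'cV[R]_n) (t : R), t != 0 /\
    block_mx P u 0 t%:M *m G *m (block_mx P u 0 t%:M)^T = 1%:M.
Proof.
move=> IH [GT Gpos].
pose A := ulsubmx G; pose b := ursubmx G; pose d := drsubmx G 0 0.
have GE : G = block_mx A b b^T d%:M.
  rewrite -[LHS]submxK [drsubmx G]mx11_scalar; congr block_mx.
  by rewrite /b trmx_ursub GT.
have AT : A^T = A by rewrite /A trmx_ulsub GT.
have dE (x : 'rV_n) (y : R) : dot G (row_mx x y%:M) (row_mx x y%:M) =
    dot A x x + 2 * y * (x *m b) 0 0 + d * y ^+ 2.
  rewrite /dot {1}GE mul_row_block tr_row_mx mul_row_col !mulmxDl tr_scalar_mx.
  have -> : y%:M *m b^T *m x^T = y *: (x *m b)^T.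
    by rewrite mul_scalar_mx -scalemxAl trmx_mul.
  rewrite !mul_mx_scalar !scale_scalar_mx.
  by move: (x *m A *m _) (x *m b) => u v; rewrite !mxE eqxx !mulr1n; ring.
have d0 : 0 < d.
  have /Gpos : row_mx 0 1%:M != 0 :> 'rV[R]_(n + 1).
    by rewrite row_mx_eq0 eqxx /=; apply/eqP => /matrixP/(_ 0 0)/eqP;
      rewrite !mxE eqxx oner_eq0.
  by rewrite dE /dot !mul0mx !mxE mulr0 !add0r expr1n mulr1.
have dn0 : d != 0 by rewrite gt_eqF.
pose A' := A - d^-1 *: (b *m b^T).
have A'ip : inner_product A'.
  split=> [|x x0].
    by rewrite /A' linearB linearZ /= trmx_mul trmxK AT.
  (* This y minimises the form of G at (x, y), and the minimum is the Schur complement at x. *)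
  pose y := - (d^-1 * (x *m b) 0 0).
  have /Gpos : row_mx x y%:M != 0 :> 'rV[R]_(n + 1) by rewrite row_mx_eq0 negb_and x0.
  suff -> : dot A' x x = dot G (row_mx x y%:M) (row_mx x y%:M) by [].
  rewrite dE /y /dot /A' mulmxBr mulmxBl -scalemxAr -scalemxAl !mulmxA.
  rewrite -(mulmxA (x *m b)) -trmx_mul.
  move: (x *m A *m _) (x *m b) => u v; rewrite !mxE big_ord1 !mxE.
  by field.
have [P PA] := IH _ A'ip.
(* The choice of u makes the first rows orthogonal to the last basis vector, which is then
   normalised. *)
exists P, (- (d^-1 *: (P *m b))), (Num.sqrt d)^-1.
have s0 : Num.sqrt d != 0 by rewrite gt_eqF // sqrtr_gt0.
split; first by rewrite invr_eq0.
rewrite GE tr_block_mx !mulmx_block !mul0mx !add0r trmx0 tr_scalar_mx.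
rewrite -[RHS]/(1%:M : 'M_(n + 1)) scalar_mx_block.
have Z : P *m b + - (d^-1 *: (P *m b)) *m d%:M = 0.
  by rewrite mul_mx_scalar scalerN scalerA mulfV // scale1r subrr.
have ZT : b^T *m P^T + d%:M *m (- (d^-1 *: (P *m b)))^T = 0.
  by rewrite -[d%:M]tr_scalar_mx -!trmx_mul -raddfD /= Z trmx0.
rewrite Z !mul0mx !mulmx0 !addr0 !add0r -!(mulmxA _%:M) -mulmxDr ZT mulmx0.
congr block_mx; rewrite ?mulmx0 ?add0r.
  rewrite -PA /A' mulmxBr -scalemxAr !mulmxBl -!scalemxAl mulNmx -scalemxAl !mulmxA.
  by rewrite mulmxDl mulNmx -scalemxAl.
rewrite -!scalar_mxM; congr _%:M.
by rewrite -{2}(sqr_sqrtr (ltW d0)); field.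
Qed.

Lemma orthonormal_frame n (G : 'M[R]_n) : inner_product G ->
  exists P : 'M_n, P *m G *m P^T = 1%:M.
Proof.
elim: n G => [|n IH] G; first by exists 0; apply/matrixP => -[].
move: G; rewrite -addn1 => G Gip.
have [P [u [t [_ E]]]] := orthonormal_frame_step IH Gip.
by exists (block_mx P u 0 t%:M).
Qed.
End Frames.

Section Matrix6.
Variable R : realType.

(** Carries the polynomial identities on natural indices over to matrix algebra. *)
Definition mx6 (f : nat -> nat -> R) : 'M[R]_6 := \matrix_(i, j) f i j.

Lemma sum6E (F : nat -> R) : \sum_(i < 6) F i = sum6 F.
Proof. by rewrite !big_ord_recl big_ord0 addr0. Qed.

Lemma mx6M f g : mx6 f *m mx6 g = mx6 (fun i j => sum6 (fun k => f i k * g k j)).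
Proof.
apply/matrixP => i j; rewrite !mxE -sum6E; apply: eq_bigr => k _; by rewrite !mxE.
Qed.

Lemma eq_mx6 f g : (forall i j, (i < 6)%N -> (j < 6)%N -> f i j = g i j) -> mx6 f = mx6 g.
Proof. by move=> e; apply/matrixP => i j; rewrite !mxE e. Qed.

Lemma mx6_scalar a : mx6 (fun i j => if Nat.eqb i j then a else 0) = a%:M.
Proof.
apply/matrixP => i j; rewrite !mxE -val_eqE /=.
by case: PeanoNat.Nat.eqb_spec => [->|/eqP/negPf->]; rewrite ?eqxx.
Qed.

Lemma mx6_sum f g :
  sum6 (fun i => sum6 (fun j => f i j * g j i)) = \tr (mx6 f *m mx6 g).
Proof. by rewrite mx6M -sum6E; apply: eq_bigr => i _; rewrite mxE. Qed.
End Matrix6.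

(** * The obstruction for a nondegenerate 2-form *)

Section CentralExtension.
Variable R : realType.

(** A 2-form on the first six coordinates, extended with the central vector in its kernel. *)
Definition extend7 (A : 'M[R]_6) : 'M[R]_7 := block_mx A 0 0 (0 : 'M_1).

Lemma extend7_tr A : A^T = - A -> (extend7 A)^T = - extend7 A.
Proof.
move=> AT.
by rewrite /extend7 (@tr_block_mx _ 6 1 6 1) AT !trmx0 (@opp_block_mx _ 6 1 6 1) !oppr0.
Qed.

Lemma delta_extend7 A : (delta_mx 0 ord_max : 'rV[R]_7) *m extend7 A = 0.
Proof.
rewrite -rowE /extend7; apply/rowP => j; rewrite !mxE.
have -> : ord_max = rshift 6 (ord0 : 'I_1) :> 'I_7 by apply: val_inj.
by case: (@split_ordP 6 1 j) => l ->; rewrite (unsplitK (inr ord0)) ?row_mxEl ?row_mxEr mxE.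
Qed.

Lemma delta_max_neq0 : (delta_mx 0 ord_max : 'rV[R]_7) != 0.
Proof. by apply/eqP => /matrixP/(_ 0 ord_max)/eqP; rewrite !mxE !eqxx oner_eq0. Qed.
End CentralExtension.

(** In an orthonormal frame ending in a multiple of e, the hypotheses become those of
    [su3_no_square], while d phi /\ phi = 0 makes the trace in its conclusion vanish. *)
Lemma nilsoliton_not_purely_coclosed (R : realType) (L : lieAlgebra R 7) (W1 : 'M[R]_6)
    (G : 'M[R]_7) (phi : kform R 7 3) :
  let W := extend7 W1 in
  let e : 'rV[R]_7 := delta_mx 0 ord_max in
  (forall x y, L x y = - dot W x y *: e) -> W1^T = - W1 -> W1 \in unitmx ->
  nilsoliton L G -> purely_coclosed L phi -> g2_induces phi G -> False.
Proof.
move=> W e LE W1T uW1 Gsol [g2 [G' [o' [cG' dstar]]] dphi] [o cG].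
(* The star in the coclosedness condition belongs to the given metric, by uniqueness. *)
have [? ?] := g2_compatible_unique g2 cG cG'; subst G' o'.
have phialt : is_alternating phi by case: g2.
have Gip := Gsol.1.
have WT : W^T = - W by apply: extend7_tr.
have eW : e *m W = 0 by apply: delta_extend7.
have e0 : e != 0 by apply: delta_max_neq0.
(* The zero block makes the last frame vector t e. *)
have [P1 [u [t [t0 PGP]]]] := @orthonormal_frame_step R 6 G (@orthonormal_frame R 6) Gip.
set P : 'M[R]_7 := block_mx P1 u 0 t%:M in PGP.
have HE := orthonormal_invmx PGP.
have uP : P \in unitmx.
  have [] := mulmx1_unit PGP; by rewrite unitmx_tr.
have P6 : row (inord 6) P = t *: e.
  have -> : inord 6 = rshift 6 (ord0 : 'I_1) :> 'I_7 by apply: val_inj; rewrite /= inordK.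
  apply/rowP => i; rewrite mxE /P /block_mx (@col_mxEd R 6 1 7) mxE [RHS]mxE mxE eqxx /=.
  case: (@split_ordP 6 1 i) => j ->; rewrite !mxE ?ord1 -val_eqE /= ?mulr1 //.
  by rewrite ltn_eqF // mulr0.
pose A := P1 *m W1 *m P1^T.
have PWP : P *m W *m P^T = block_mx A 0 0 (0 : 'M_1).
  rewrite /P /W (@tr_block_mx _ 6 1 6 1) !(@mulmx_block _ 6 1 6 1 6 1).
  by rewrite !(mulmx0, mul0mx, addr0, add0r, trmx0).
have uA : A \in unitmx.
  have uP1 : P1 \in unitmx.
    move: uP; rewrite !unitmxE /P (@det_ublock _ 6 1) !unitfE mulf_eq0.
    by rewrite negb_or => /andP[].
  by rewrite /A !unitmx_mul unitmx_tr uP1 uW1.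
(* In the frame the nilsoliton condition reads A^3 = k A, and A is invertible. *)
have [k Ak] : exists k, A *m A = k%:M.
  have [k] := (nilsoliton_centralP LE WT eW Gip e0).1 Gsol; rewrite HE => Wk.
  exists k; have AAA : A *m A *m A = k *: A.
    have : (P *m W *m P^T) *m (P *m W *m P^T) *m (P *m W *m P^T) = k *: (P *m W *m P^T).
      transitivity (P *m (W *m (P^T *m P) *m W *m (P^T *m P) *m W) *m P^T).
        by rewrite !mulmxA.
      by rewrite Wk -scalemxAr -scalemxAl.
    rewrite PWP !(@mulmx_block _ 6 1 6 1 6 1) (@scale_block_mx _ 6 1 6 1).
    rewrite !(mulmx0, mul0mx, addr0, add0r, scaler0) => /(congr1 (@ulsubmx _ 6 1 6 1)).
    by rewrite !block_mxKul.
  by rewrite -[LHS](mulmxK uA) AAA -scalemxAl mulmxV // scalemx1.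
have k0 : k != 0.
  have : A *m A \in unitmx by rewrite unitmx_mul uA.
  by rewrite Ak unitmxE det_scalar unitfE expf_eq0.
(* Rescaled so that brackets are - w times the last frame vector t e. *)
pose w x y := t^-1 * dot W x y.
have LE' x y : L x y = - w x y *: row (inord 6) P.
  by rewrite LE P6 scalerA mulNr mulrAC mulVf // mul1r.
pose wl := coef P (form2 w).
pose c := coef P phi.
have walt : is_alternating (form2 w) by apply: form2_alt.
have calt : altseq 3 c by apply: coef_altseq.
have wlalt : altseq 2 wl by apply: coef_altseq.
have wlE i j : (i < 6)%N -> (j < 6)%N -> omega_coef wl i j = t^-1 * A (inord i) (inord j).
  move=> i6 j6; rewrite /omega_coef -(signed_evalE wlalt) // /wl coef_form2 /w dot_rows PWP /=.
  have lift6 l : (l < 6)%N -> inord l = lshift 1 (inord l : 'I_6) :> 'I_7.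
    by move=> l6; apply: val_inj; rewrite /= !inordK // ltnW.
  by rewrite (lift6 i) // (lift6 j) // (@block_mxEul _ 6 1 6 1).
have wl6 i : wl [:: i; 6] = 0.
  rewrite /wl coef_form2 /w dot_rows PWP /=.
  have -> : inord 6 = rshift 6 (ord0 : 'I_1) :> 'I_7 by apply: val_inj; rewrite /= inordK.
  case: (@split_ordP 6 1 (inord i)) => l ->.
    by rewrite (@block_mxEur _ 6 1 6 1) mxE mulr0.
  by rewrite (@block_mxEdr _ 6 1 6 1) mxE mulr0.
pose vol := volume G o P.
have vol0 : vol != 0.
  have dP : \det P != 0 by rewrite -unitfE -unitmxE.
  have dG : \det G = (\det P ^+ 2)^-1.
    have := congr1 determinant PGP; rewrite !det_mulmx det_tr det1 mulrAC -expr2.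
    by move=> /(canRL (mulKf (expf_neq0 2 dP))); rewrite mulr1.
  by rewrite /vol /volume !mulf_neq0 ?signr_eq0 // gt_eqF // sqrtr_gt0 dG invr_gt0 exprn_even_gt0.
(* The frame is orthonormal, so the G2 bilinear form is 6 vol times the identity. The entry (6, 6)
   makes sigma invertible, the entries (6, j) give sigma /\ rho = 0, and the rest give the product
   of sigma and K. *)
have g2E i j : (i < 7)%N -> (j < 7)%N -> g2_coef c i j = if Nat.eqb i j then 6 * vol else 0.
  move=> i7 j7; have := cG.2 (row (inord i) P) (row (inord j) P) P.
  rewrite dot_rows PGP -/vol => E.
  have -> : g2_coef c i j = g2_bilin phi (row (inord i) P) (row (inord j) P) P.
    transitivity (coef P (g2_bilin phi (row (inord i) P) (row (inord j) P)) (iota 0 7));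
      last by rewrite /coef frame_rows_iota.
    rewrite /g2_bilin (@coef_wedge R 6 7 P 4 3) //; last first.
      by apply: (@wedge_alt R 7 2 2); apply: interior_alt.
    apply: eq_shuffle => // s ss _; last by rewrite -(signed_evalE calt).
    rewrite (@coef_wedge R 6 7 P 2 2) //; try exact: interior_alt.
    by apply: eq_shuffle => // v sv _;
      rewrite (@coef_interior R 6 7 P 2) -(signed_evalE calt) //= sv.
  have n6 : (6 : R) != 0 by rewrite pnatr_eq0.
  rewrite -[LHS](mulVKf n6) -E mxE -val_eqE /= !inordK //.
  by case: PeanoNat.Nat.eqb_spec => [->|/eqP/negPf->]; rewrite ?eqxx ?mul1r // mul0r mulr0.
have n3 : (3 : R) != 0 by rewrite pnatr_eq0.
have SX : mx6 (sigma_coef c) *m mx6 (sigma_sq c) = (- 2 * vol)%:M.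
  rewrite mx6M -mx6_scalar; apply: eq_mx6 => i j i6 j6; apply: (mulfI n3).
  by rewrite sigma_sigma_sq // g2E //=; case: Nat.eqb; [ring | rewrite mulr0].
have p0 : - 2 * vol != 0 by rewrite mulf_neq0 ?oppr_eq0 ?pnatr_eq0.
have uS : mx6 (sigma_coef c) \in unitmx.
  have : mx6 (sigma_coef c) *m ((- 2 * vol)^-1 *: mx6 (sigma_sq c)) = 1%:M.
    by rewrite -scalemxAr SX scale_scalar_mx mulVf.
  by case/mulmx1_unit.
have rho0 i : (i < 6)%N -> sigma_rho c i = 0.
  move=> i6; pose T : 'cV_6 := \col_(k < 6) sigma_rho c k.
  have T0 : T = 0.
    apply: (can_inj (mulKmx uS)); rewrite mulmx0; apply/colP => j; rewrite !mxE.
    have := g2_coef6 c (ltn_ord j); rewrite g2E // ?(ltn_trans (ltn_ord j)) //.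
    have -> : Nat.eqb 6 j = false.
      by apply/PeanoNat.Nat.eqb_neq => e'; have := ltn_ord j; rewrite -e'.
    move/esym/eqP; rewrite mulf_eq0 oppr_eq0 (negPf n3) /= -sum6E => /eqP e6.
    by rewrite -[RHS]e6; apply: eq_bigr => l _; rewrite !mxE.
  by move/colP/(_ (Ordinal i6)): T0; rewrite !mxE.
(* Coclosedness is evaluated on the five vectors of U other than the i-th. *)
have omr i : (i < 6)%N -> omega_rho c wl i = 0.
  move=> i6; have := dstar (frame_rows 5 P (compl 6 [:: i])).
  rewrite -[LHS]/(coef P (ce_diff L _) _).
  rewrite (coef_ce_diff4 P LE'); first last.
  - by case: i i6 => [|[|[|[|[|[|]]]]]].
  - exact: (@hodge_alt R 3 4 G o phi).
  pose D := coef 1%:M (fun M : 'M[R]_7 => \det M).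
  pose C := (-1) ^+ o * Num.sqrt (\det G) * \det P * 3`!%:R^-1.
  have C0 : C != 0.
    apply: mulf_neq0; first exact: vol0.
    by rewrite invr_eq0 pnatr_eq0.
  have Dalt : altseq 7 D by exact/coef_altseq/det_alternating.
  have D1 : D (iota 0 7) = 1 by rewrite /D /coef frame_rows_iota det1.
  rewrite (@eq_shuffle R 2 3 _ _ (signed_eval wl) _ (fun u => C *
      list_sum (compl 7 (6%N :: u)) 3 (fun v => signed_eval c v * signed_eval D (v ++ 6%N :: u)))).
  - rewrite shuffleZr => /eqP; rewrite mulf_eq0 (negPf C0) /= => /eqP sh0.
    have := omega_hodge c wl D i6; rewrite sh0 mulr0 D1 mulr1 => /esym/eqP.
    by rewrite mulf_eq0 oppr_eq0 (negPf n3) => /eqP.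
  - by case: i i6 => [|[|[|[|[|[|]]]]]].
  - by move=> v sv _; rewrite -(signed_evalE wlalt) // /wl coef_form2.
  move=> v sv _; rewrite (@coef_interior R 6 7 P 3).
  rewrite (@coef_hodge R 2 4 P G o phi) //; last by rewrite /= sv.
  rewrite mulrA; congr (_ * _).
  rewrite -complE; apply: eq_list_sum => v' sv' _; rewrite -(signed_evalE calt) //.
  by rewrite -(signed_evalE Dalt) // size_cat /= sv' sv.
have tr0 : \tr (mx6 (omega_coef wl) *m mx6 (sigma_sq c)) = 0.
  have := dphi P; have -> : wedge (ce_diff L phi) phi P =
      coef P (wedge (ce_diff L phi) phi) (iota 0 7) by rewrite /coef frame_rows_iota.
  rewrite (@coef_wedge R 6 7 P 4 3) //; last first.
    exact: eq_alternating (fun M => ce_diff3_wedge LE' walt M phialt)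
      (wedge_alt walt (interior_alt _ phialt)).
  move=> E; rewrite -mx6_sum; apply: oppr_inj; rewrite oppr0 -omega_sigma_sq //.
  rewrite -[RHS](mulr0 2) -[in RHS]E; congr (_ * _).
  apply: eq_shuffle => // v sv _; last first.
    by rewrite -(signed_evalE calt).
  rewrite (coef_ce_diff3 P LE') //; apply: eq_shuffle => // v' sv' _.
    by rewrite -(signed_evalE wlalt) // /wl coef_form2.
  by rewrite (@coef_interior R 6 7 P 2) -(signed_evalE calt) //= sv'.
suff : \tr (mx6 (omega_coef wl) *m mx6 (sigma_sq c)) != 0 by rewrite tr0 eqxx.
have omE : mx6 (omega_coef wl) = t^-1 *: A.
  apply/matrixP => a b; rewrite [LHS]mxE [RHS]mxE wlE //.
  by congr (_ * A _ _); apply: val_inj; rewrite /= inordK.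
(* Both scalars - 2 vol are 6 vol divided by the factor - 3 of the identities; omega is A / t, whose
   square is k / t^2. *)
apply: (@su3_no_square R (mx6 (sigma_coef c)) (mx6 (hitchin_coef c)) (mx6 (omega_coef wl))
  (mx6 (sigma_sq c)) (- 2 * vol) (- 2 * vol)
  (sum6 (fun k => hitchin_coef c 0%N k * hitchin_coef c k 0%N)) (t ^- 2 * k)) => //.
- apply/matrixP => a b; rewrite !mxE /sigma_coef -!(signed_evalE calt) //.
  exact: (calt.1 [:: 6%N] b a [::]).
- by rewrite omE linearZ /= -scalerN /A !trmx_mul trmxK W1T mulNmx mulmxN mulmxA.
- rewrite mx6M -mx6_scalar; apply: eq_mx6 => a b a6 b6; apply: (mulfI n3).
  have := g2_coef_hitchin c a6 b6; rewrite g2E ?(ltn_trans a6) ?(ltn_trans b6) //.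
  have -> : sum6 (fun l => sigma_rho c l * signed_eval c [:: a; b; l]) = 0.
    by rewrite /sum6 !rho0 // !mul0r !addr0.
  rewrite mulr0 sub0r => /(congr1 (fun x => - x)); rewrite opprK => <-.
  by case: Nat.eqb; [ring | rewrite mulr0 oppr0].
- by rewrite mx6M -mx6_scalar; apply: eq_mx6 => a b a6 b6; rewrite hitchin_sq.
- apply/matrixP => a b; rewrite mx6M !mxE; apply/eqP; rewrite -subr_eq0; apply/eqP.
  rewrite hitchin_omega //; rewrite /sum6 !omr //; ring.
- by rewrite omE -scalemxAl -scalemxAr Ak scalerA scale_scalar_mx expr2 invfM.
- by rewrite mulf_neq0 ?invr_eq0 ?expf_neq0.
Qed.

(** * The two Lie algebras *)

Section Example.
Variable R : realType.

Lemma dot_extend7 f (x y : 'rV[R]_7) : dot (extend7 (mx6 f)) x y =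
  sum6 (fun i => sum6 (fun j => x 0 (inord i) * f i j * y 0 (inord j))).
Proof.
have lift6 (l : 'I_6) : inord l = lshift 1 l :> 'I_7.
  by apply: val_inj; rewrite /= inordK // ltnW // ltnS.
rewrite /dot -[x](@hsubmxK _ 1 6 1) -[y](@hsubmxK _ 1 6 1) /extend7.
rewrite (@mul_row_block _ 1 6 1 6 1) !mulmx0 !addr0 (@tr_row_mx _ 1 6 1).
rewrite (@mul_row_col _ 1 6 1 1) mul0mx addr0 mxE -sum6E.
under eq_bigr => j _ do rewrite mxE mulr_suml.
rewrite exchange_big; apply: eq_bigr => i _; rewrite -sum6E; apply: eq_bigr => j _.
by rewrite !lift6 !(@row_mxEl _ 1 6 1) !mxE.
Qed.

Definition h5R2_coef i j : R :=
  match i, j with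
  | 0%N, 1%N | 2%N, 3%N => 1
  | 1%N, 0%N | 3%N, 2%N => - 1
  | _, _ => 0
  end.

Definition h7_coef i j : R :=
  match i, j with
  | 0%N, 1%N | 2%N, 3%N | 4%N, 5%N => 1
  | 1%N, 0%N | 3%N, 2%N | 5%N, 4%N => - 1
  | _, _ => 0
  end.

Lemma central_bracketE w (f : nat -> nat -> R) :
  (forall x y, w x y = dot (extend7 (mx6 f)) x y) ->
  forall x y, central_bracket w x y = - dot (extend7 (mx6 f)) x y *: delta_mx 0 ord_max.
Proof.
move=> wE x y; apply/rowP => i; rewrite !mxE wE.
by case: eqP; rewrite ?mulr1 ?mulr0.
Qed.

Lemma w_h5R2E x y : w_h5R2 x y = dot (extend7 (mx6 h5R2_coef)) x y.
Proof. by rewrite dot_extend7 /sum6 /w_h5R2 /f2 /f1 /=; ring. Qed.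

Lemma w_h7E x y : w_h7 x y = dot (extend7 (mx6 h7_coef)) x y.
Proof. by rewrite dot_extend7 /sum6 /w_h7 /f2 /f1 /=; ring. Qed.

Lemma mx6_h7_sq : mx6 h7_coef *m mx6 h7_coef = (- 1)%:M.
Proof.
rewrite mx6M -mx6_scalar; apply: eq_mx6 => i j; case6 i; case6 j;
  rewrite /sum6 /=; ring.
Qed.

Lemma mx6_h5R2_cube : mx6 h5R2_coef *m mx6 h5R2_coef *m mx6 h5R2_coef = - mx6 h5R2_coef.
Proof.
rewrite !mx6M; transitivity (mx6 (fun i j => - h5R2_coef i j)); last first.
  by apply/matrixP => i j; rewrite !mxE.
apply: eq_mx6 => i j; case6 i; case6 j; rewrite /sum6 /=; ring.
Qed.

Lemma mx6_h5R2_tr : (mx6 h5R2_coef)^T = - mx6 h5R2_coef.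
Proof.
by apply/matrixP => i j; rewrite !mxE; case: i => -[|[|[|[|[|[|//]]]]]] ?;
  case: j => -[|[|[|[|[|[|//]]]]]] ?; rewrite /= ?opprK ?oppr0.
Qed.

Lemma mx6_h7_tr : (mx6 h7_coef)^T = - mx6 h7_coef.
Proof.
by apply/matrixP => i j; rewrite !mxE; case: i => -[|[|[|[|[|[|//]]]]]] ?;
  case: j => -[|[|[|[|[|[|//]]]]]] ?; rewrite /= ?opprK ?oppr0.
Qed.

Lemma h7_not_purely_coclosed (G : 'M[R]_7) (phi : kform R 7 3) :
  nilsoliton (h7 R) G -> purely_coclosed (h7 R) phi -> ~ g2_induces phi G.
Proof.
move=> sol pc ind.
apply: (@nilsoliton_not_purely_coclosed R (h7 R) (mx6 h7_coef) G phi) => //.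
- exact: (central_bracketE w_h7E).
- exact: mx6_h7_tr.
have : mx6 h7_coef *m (- mx6 h7_coef) = 1%:M by rewrite mulmxN mx6_h7_sq raddfN /= opprK.
by case/mulmx1_unit.
Qed.

(* phi_0 = e^7 /\ sigma + Re ((e^1 + i e^2)(e^3 - i e^4)(e^5 + i e^6)), with
   sigma = e^12 - e^34 + e^56, on the standard frame, indexed from 0 *)
Definition phi0_terms : seq (R * seq nat) :=
  [:: (1, [:: 0%N; 1%N; 6%N]); (- 1, [:: 2%N; 3%N; 6%N]); (1, [:: 4%N; 5%N; 6%N]);
      (1, [:: 0%N; 2%N; 4%N]); (1, [:: 0%N; 3%N; 5%N]); (1, [:: 1%N; 3%N; 4%N]);
      (- 1, [:: 1%N; 2%N; 5%N])].

Definition phi0_term i : R * seq nat := nth (0, [::]) phi0_terms i.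

(** Each determinant is the 3 x 3 minor of M on the columns of one term, i.e. a decomposable basis
    form. *)
Definition phi0 : kform R 7 3 := fun M =>
  \sum_(i < 7) (phi0_term i).1 *
    \det (M *m (frame_rows 3 (1%:M : 'M[R]_7) (phi0_term i).2)^T).

(** The components on increasing lists, as a function that evaluates. *)
Definition phi0_coef (t : seq nat) : R :=
  match t with
  | [:: 0%N; 1%N; 6%N] | [:: 4%N; 5%N; 6%N] | [:: 0%N; 2%N; 4%N]
  | [:: 0%N; 3%N; 5%N] | [:: 1%N; 3%N; 4%N] => 1
  | [:: 2%N; 3%N; 6%N] | [:: 1%N; 2%N; 5%N] => - 1
  | _ => 0
  end.

Lemma phi0_alt : is_alternating phi0.
Proof. by apply: alternating_sum => i; apply: mulmxr_alt; apply: det_alternating. Qed.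

Definition det3 (f : nat -> nat -> R) :=
  f 0%N 0%N * (f 1%N 1%N * f 2%N 2%N - f 1%N 2%N * f 2%N 1%N)
  - f 0%N 1%N * (f 1%N 0%N * f 2%N 2%N - f 1%N 2%N * f 2%N 0%N)
  + f 0%N 2%N * (f 1%N 0%N * f 2%N 1%N - f 1%N 1%N * f 2%N 0%N).

Lemma det3E (f : nat -> nat -> R) : \det (\matrix_(i < 3, j < 3) f i j) = det3 f.
Proof.
rewrite (expand_det_row _ ord0) !big_ord_recl big_ord0 /cofactor.
rewrite !(expand_det_row _ ord0) !big_ord_recl !big_ord0 /cofactor !det_mx11.
by rewrite /det3 !mxE /= /bump /= !(add0n, add1n, addSn); ring.
Qed.

Definition kron i j : R := if Nat.eqb i j then 1 else 0.

Lemma coef_phi0_sum t : size t = 3 -> all (fun i => i < 7)%N t ->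
  coef 1%:M phi0 t = foldr (fun p r => p.1 *
    det3 (fun i j => kron (nth 0%N t i) (nth 0%N p.2 j)) + r) 0 phi0_terms.
Proof.
move=> st tn; rewrite /coef /phi0.
transitivity (\sum_(i < 7) (phi0_term i).1 *
    det3 (fun j l => kron (nth 0%N t j) (nth 0%N (phi0_term i).2 l))).
  apply: eq_bigr => i _; rewrite -det3E; congr (_ * \det _); apply/matrixP => j l.
  rewrite !mxE (bigD1 (inord (nth 0%N t j))) //= big1 => [|q qj]; last first.
    by rewrite !mxE eq_sym (negPf qj) mul0r.
  rewrite addr0 !mxE eqxx mul1r /kron.
  have tj : (nth 0%N t j < 7)%N by apply: (allP tn); rewrite mem_nth // st.
  have il : (nth 0%N (phi0_term i).2 l < 7)%N.
    by case: i => -[|[|[|[|[|[|[|//]]]]]]] ?; case: l => -[|[|[|//]]] ?.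
  rewrite -val_eqE /= !inordK // eq_sym.
  by case: PeanoNat.Nat.eqb_spec => [->|/eqP/negPf->]; rewrite ?eqxx.
by rewrite !big_ord_recl big_ord0.
Qed.

(** Runs through the masks of 0, .., 6 and discards those of the wrong size. *)
Ltac all_masks := do 7! (case=> [|[]] //); case=> [|//] _ //=.

Lemma coef_phi0 t : size t = 3 -> all (fun i => i < 7)%N t ->
  coef 1%:M phi0 t = signed_eval phi0_coef t.
Proof.
apply: altseq_ext; first exact/coef_altseq/phi0_alt.
all_masks => _; rewrite coef_phi0_sum //= /det3 /kron /=; ring.
Qed.

(** * Verification of the explicit example *)

Let e7 : 'rV[R]_7 := row (inord 6) 1%:M.

Lemma e7E : e7 = delta_mx 0 ord_max.
Proof.
by rewrite /e7 row1; congr delta_mx; apply: val_inj; rewrite /= inordK.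
Qed.

Let W := extend7 (mx6 h5R2_coef).
(* The factor 1 is for form2_alt. *)
Let w x y := 1 * dot W x y.

Lemma h5R2E x y : h5R2 R x y = - w x y *: e7.
Proof. by rewrite /w mul1r e7E -(central_bracketE w_h5R2E). Qed.

Lemma w_alt : is_alternating (form2 w).
Proof. exact: form2_alt (extend7_tr mx6_h5R2_tr). Qed.

Definition w_coef (t : seq nat) : R :=
  match t with [:: 0%N; 1%N] | [:: 2%N; 3%N] => 1 | _ => 0 end.

Lemma coef_w t : size t = 2 -> all (fun i => i < 7)%N t ->
  coef 1%:M (form2 w) t = signed_eval w_coef t.
Proof.
apply: altseq_ext; first exact/coef_altseq/w_alt.
have row1E a b : (a < 7)%N -> (b < 7)%N ->
    row (inord a : 'I_7) (1%:M : 'M[R]_7) 0 (inord b) = kron a b.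
  move=> a7 b7; rewrite !mxE -val_eqE /= !inordK // /kron.
  by case: PeanoNat.Nat.eqb_spec => [->|/eqP/negPf->]; rewrite ?eqxx.
have dotE a b : (a < 7)%N -> (b < 7)%N ->
    dot W (row (inord a) 1%:M) (row (inord b) 1%:M) =
    sum6 (fun i => sum6 (fun j => kron a i * h5R2_coef i j * kron b j)).
  by move=> a7 b7; rewrite dot_extend7 /sum6 !row1E.
by all_masks => _; rewrite coef_form2 /w dotE // /sum6 /kron /=; ring.
Qed.

Let vol := coef 1%:M (fun M : 'M[R]_7 => \det M).

Lemma coef_vol t : size t = 7 -> all (fun i => i < 7)%N t -> vol t = signed_eval (fun=> 1) t.
Proof.
apply: altseq_ext; first exact/coef_altseq/det_alternating.
by all_masks => _; rewrite /vol /coef -[X in frame_rows _ _ X]/(iota 0 7) frame_rows_iota det1.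
Qed.

Definition sum7 (F : nat -> R) := sum6 F + F 6%N.

Lemma sum7E (F : nat -> R) : \sum_(i < 7) F i = sum7 F.
Proof. by rewrite big_ord_recr sum6E. Qed.

Ltac evaluate :=
  cbv beta iota zeta delta [sum7 sum6 phi0_coef w_coef compl list_sum foldr
    signed_eval signed_sort insert_sorted shuffle Nat.compare Nat.eqb filter List.existsb
    iota cat addb negb orb].

Lemma subset_lt7 (s t : seq nat) : all (fun i => i < 7)%N t -> {subset s <= t} ->
  all (fun i => i < 7)%N s.
Proof. by move=> /allP t7 st; apply/allP => i /st /t7. Qed.

Lemma mask_lt7 m : all (fun i => i < 7)%N (mask m (iota 0 7)).
Proof. by apply/allP => i /mem_mask; rewrite mem_iota. Qed.

(** Both sides are alternating of top degree, so the standard basis suffices. The minus sign makes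
    the orientation opposite to the standard one, hence [true] below. *)
Lemma g2_bilin_phi0 v v' M :
  g2_bilin phi0 v v' M = - 6 * dot 1%:M v v' * \det M.
Proof.
have balt : is_alternating (g2_bilin phi0 v v').
  apply: (@wedge_alt R 7 4 3) phi0_alt.
  by apply: (@wedge_alt R 7 2 2); apply/interior_alt/phi0_alt.
(* The difference of the two sides is a sum over [bool], so that [alternating_sum] applies. *)
pose c (b : bool) : R := if b then 1 else 6 * dot 1%:M v v'.
pose F (b : bool) : kform R 7 7 := if b then g2_bilin phi0 v v' else (fun M => \det M).
have Falt : is_alternating (fun M => \sum_b c b * F b M).
  by apply: alternating_sum => -[] //; apply: det_alternating.
suff : \sum_b c b * F b M = 0.
  by rewrite big_bool /= mul1r => /eqP; rewrite addr_eq0 !mulNr => /eqP.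
apply: (alternating_eq0 Falt); all_masks => _.
rewrite /coef big_bool /= mul1r -[X in frame_rows _ _ X]/(iota 0 7) frame_rows_iota det1 mulr1.
have dotE : dot 1%:M v v' = sum7 (fun a => v 0 (inord a) * v' 0 (inord a)).
  rewrite /dot mulmx1 mxE -sum7E; apply: eq_bigr => a _.
  by rewrite mxE inord_val.
have intE u a : size a = 2 -> {subset a <= iota 0 7} ->
    coef 1%:M (interior u (phi0 : kform R 7 (1 + 2))) a =
    sum7 (fun i => u 0 (inord i) * signed_eval phi0_coef (i :: a)).
  move=> sa sub; have a7 := subset_lt7 (t := iota 0 7) isT sub.
  rewrite /coef (@interior_sum R 7 2); last exact: phi0_alt.
  rewrite -sum7E; apply: eq_bigr => i _.
  rewrite -[X in row X _](inord_val i) inord_val -coef_phi0 /= ?sa ?ltn_ord //.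
  by rewrite -(@coef_interior R 6 7 1%:M 2) inord_val.
have -> : g2_bilin phi0 v v' 1%:M = shuffle 4 3 (iota 0 7) (fun t => shuffle 2 2 t
     (fun u => sum7 (fun a => v 0 (inord a) * signed_eval phi0_coef (a :: u)))
     (fun u => sum7 (fun a => v' 0 (inord a) * signed_eval phi0_coef (a :: u))))
     (signed_eval phi0_coef).
  transitivity (coef 1%:M (g2_bilin phi0 v v') (iota 0 7));
    first by rewrite /coef frame_rows_iota.
  rewrite /g2_bilin (@coef_wedge R 6 7 _ 4 3) //; first last.
  - exact: phi0_alt.
  - by apply: (@wedge_alt R 7 2 2); apply/interior_alt/phi0_alt.
  apply: eq_shuffle => // s ss sub; last by rewrite coef_phi0 // (subset_lt7 _ sub).
  rewrite (@coef_wedge R 6 7 _ 2 2) //; try exact/interior_alt/phi0_alt.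
  by apply: eq_shuffle => // a sa suba; apply: intE => // i /suba/sub.
rewrite dotE; evaluate; ring.
Qed.

(** No term of rho contains e^12 or e^34, so omega contracts to 0 with rho; this is verified by
    evaluation on increasing lists. *)
Lemma phi0_coclosed M : ce_diff (h5R2 R) (@hodge R 3 4 1%:M true phi0) M = 0.
Proof.
have halt := @hodge_alt R 3 4 1%:M true phi0.
have alt : is_alternating (ce_diff (h5R2 R) (@hodge R 3 4 1%:M true phi0)).
  apply: eq_alternating (fun M => ce_diff4_wedge h5R2E w_alt M halt) _.
  exact: (wedge_alt w_alt (interior_alt e7 halt)).
apply: (alternating_eq0 alt) => m m7 m5.
rewrite (coef_ce_diff4 1%:M h5R2E halt m5).
pose C : R := (-1) ^+ true * Num.sqrt (\det (1%:M : 'M[R]_7))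
  * \det (1%:M : 'M[R]_7) * 3`!%:R^-1.
rewrite (@eq_shuffle R 2 3 _ _ (signed_eval w_coef) _ (fun u => C *
      list_sum (compl 7 (6%N :: u)) 3 (fun v => signed_eval phi0_coef v
        * signed_eval (fun=> 1) (v ++ 6%N :: u)))).
- rewrite shuffleZr; move: m m7 m5; all_masks => _; evaluate; ring.
- by rewrite m5.
- move=> a sa suba; rewrite -coef_w ?coef_form2 //; exact: (subset_lt7 (mask_lt7 m) suba).
move=> a sa suba; rewrite (@coef_interior R 6 7 1%:M 3).
have a7 : all (fun i => i < 7)%N (6%N :: a) by rewrite /= (subset_lt7 (mask_lt7 m) suba).
rewrite (@coef_hodge R 2 4 1%:M 1%:M true phi0) //; first last.
- by rewrite /= sa.
- by rewrite trmx1 !mulmx1.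
- exact: phi0_alt.
rewrite mulrA; congr (_ * _).
rewrite -complE; apply: eq_list_sum => b sb subb.
have b7 : all (fun i => i < 7)%N b.
  by apply/allP => i /subb; rewrite complE mem_filter mem_iota => /andP[].
by rewrite coef_phi0 // -/vol coef_vol ?all_cat ?b7 // size_cat sb /= sa.
Qed.

(** The opposite signs of e^12 and e^34 in sigma make omega /\ sigma^2 cancel. *)
Lemma phi0_pure M : wedge (ce_diff (h5R2 R) phi0) phi0 M = 0.
Proof.
have dalt : is_alternating (ce_diff (h5R2 R) phi0).
  apply: eq_alternating (fun M => ce_diff3_wedge h5R2E w_alt M phi0_alt) _.
  exact: (wedge_alt w_alt (interior_alt e7 phi0_alt)).
apply: (alternating_eq0 (@wedge_alt R 7 4 3 _ _ dalt phi0_alt)).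
all_masks => _; rewrite (@coef_wedge R 6 7 1%:M 4 3 _ _ _ dalt phi0_alt) //.
rewrite (@eq_shuffle R 4 3 (iota 0 7) _ (fun t => shuffle 2 2 t
     (signed_eval w_coef) (fun u => signed_eval phi0_coef (6%N :: u))) _
     (signed_eval phi0_coef)) //; first by evaluate; ring.
  move=> s ss sub; rewrite (coef_ce_diff3 1%:M h5R2E phi0_alt) //.
  have s7 := subset_lt7 (t := iota 0 7) isT sub.
  apply: eq_shuffle => // a sa suba; have a7 := subset_lt7 s7 suba.
    by rewrite -coef_w // coef_form2.
  by rewrite (@coef_interior R 6 7 1%:M 2) coef_phi0 //= sa.
by move=> s ss sub; rewrite coef_phi0 // (subset_lt7 _ sub).
Qed.

Lemma phi0_g2 : g2_structure phi0.
Proof.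
split=> [|v v0]; first exact: phi0_alt.
exists 1%:M; rewrite g2_bilin_phi0 det1 mulr1 mulf_neq0 ?oppr_eq0 ?pnatr_eq0 //.
by rewrite gt_eqF // (inner_product1 R 7).2.
Qed.

Lemma phi0_compatible : g2_compatible phi0 1%:M true.
Proof.
split=> [|v v' M]; first exact: inner_product1.
rewrite g2_bilin_phi0 /volume det1 sqrtr1 expr1; move: (dot _ _ _) (\det M) => x y.
by field.
Qed.

Lemma h5R2_nilsoliton : nilsoliton (h5R2 R) 1%:M.
Proof.
have LE := @central_bracketE _ _ w_h5R2E.
apply/(@nilsoliton_centralP R 7 (h5R2 R) _ _ 1%:M LE (extend7_tr mx6_h5R2_tr)
  (delta_extend7 _) (inner_product1 R 7) (delta_max_neq0 R)).
(* For the standard metric J is the matrix of omega, and J^3 = - J. *)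
exists (-1); rewrite invmx1 !mulmx1 /extend7 !(@mulmx_block _ 6 1 6 1 6 1).
rewrite !(mulmx0, mul0mx, addr0, add0r) mx6_h5R2_cube.
by rewrite (@scale_block_mx _ 6 1 6 1) !scaler0 scaleN1r.
Qed.

End Example.

Theorem corollary5p3 (R : realType) :
  (exists (phi : kform R 7 3) (G : 'M[R]_7),
     purely_coclosed (h5R2 R) phi /\ g2_induces phi G /\
     nilsoliton (h5R2 R) G) /\
  (forall G : 'M[R]_7, nilsoliton (h7 R) G ->
     ~ exists phi : kform R 7 3,
         purely_coclosed (h7 R) phi /\ g2_induces phi G).
Proof.
split; last first.
  by move=> G sol [phi [pc ind]]; apply: h7_not_purely_coclosed sol pc ind.
exists (@phi0 R), 1%:M; split; last split.
- split; first exact: phi0_g2.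
    exists 1%:M, true; split; first exact: phi0_compatible.
    exact: phi0_coclosed.
  exact: phi0_pure.
- by exists true; apply: phi0_compatible.
exact: h5R2_nilsoliton.
Qed.
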